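(* Let $\Lambda$ be a row-finite $k$-graph without sources and let $R$ be a commutative ring with $1\neq0$. For a saturated hereditary subset $H$ of $\Lambda^0$ let $I_H$ be the ideal of $\mathrm{KP}_R(\Lambda)$ generated by $\{p_v:v\in H\}$. Then the map $H\mapsto I_H$ is a lattice isomorphism from the lattice of saturated hereditary subsets of $\Lambda^0$ onto the lattice of basic and graded ideals of $\mathrm{KP}_R(\Lambda)$ (both ordered by inclusion).
   Context: Conventions: $\mathbb{N}$ includes $0$, and $k$ is a positive integer. Rings and $R$-algebras are associative but not assumed to have an identity; ideals are two-sided. A $k$-graph is a countable category $\Lambda$ (with object set $\Lambda^0$, set of morphisms also written $\Lambda$, domain map $s$, codomain map $r$; $\lambda\mu$ is defined when $s(\lambda)=r(\mu)$) together with a functor $d:\Lambda\to\mathbb{N}^k$ (where $\mathbb{N}^k$ is viewed as a category with one object) with the factorization property: if $d(\lambda)=m+n$ there are unique $\mu,\nu\in\Lambda$ with $d(\mu)=m$, $d(\nu)=n$, $\lambda=\mu\nu$. Objects are identified with identity morphisms, so $\Lambda^0=d^{-1}(0)$. Write $\Lambda^n=d^{-1}(n)$ and $v\Lambda^n=\{\lambda\in\Lambda^n:r(\lambda)=v\}$. $\Lambda$ is row-finite if every $v\Lambda^n$ ($v\in\Lambda^0$, $n\in\mathbb{N}^k$) is finite, and has no sources if every $v\Lambda^n$ is nonempty. A subset $H\subset\Lambda^0$ is hereditary if $\lambda\in\Lambda$ and $r(\lambda)\in H$ imply $s(\lambda)\in H$; it is saturated if $v\in\Lambda^0$, $n\in\mathbb{N}^k$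 and $s(v\Lambda^n)\subset H$ imply $v\in H$. Let $\Lambda^{\neq0}=\{\lambda\in\Lambda:d(\lambda)\neq0\}$. For each $\lambda\in\Lambda^{\neq0}$ introduce a formal symbol $\lambda^*$ (ghost path), and let $G(\Lambda^{\neq0})=\{\lambda^*:\lambda\in\Lambda^{\neq0}\}$. A Kumjian-Pask $\Lambda$-family $(P,S)$ in an $R$-algebra $A$ consists of functions $P:\Lambda^0\to A$ and $S:\Lambda^{\neq0}\cup G(\Lambda^{\neq0})\to A$ such that: (KP1) $\{P_v:v\in\Lambda^0\}$ is a family of mutually orthogonal idempotents; (KP2) for all $\lambda,\mu\in\Lambda^{\neq0}$ with $r(\mu)=s(\lambda)$: $S_\lambda S_\mu=S_{\lambda\mu}$, $S_{\mu^*}S_{\lambda^*}=S_{(\lambda\mu)^*}$, $P_{r(\lambda)}S_\lambda=S_\lambda=S_\lambda P_{s(\lambda)}$, $P_{s(\lambda)}S_{\lambda^*}=S_{\lambda^*}=S_{\lambda^*}P_{r(\lambda)}$; (KP3) for all $\lambda,\mu\in\Lambda^{\neq0}$ with $d(\lambda)=d(\mu)$: $S_{\lambda^*}S_\mu=\delta_{\lambda,\mu}P_{s(\lambda)}$; (KP4) for all $v\in\Lambda^0$ and $n\in\mathbb{N}^k\setminus\{0\}$: $P_v=\sum_{\lambda\in v\Lambda^n}S_\lambda S_{\lambda^*}$. By convention $S_v:=P_v$ and $S_{v^*}:=P_v$ for $v\in\Lambda^0$. The Kumjian-Pask algebra $\mathrm{KP}_R(\Lambda)$ is the $R$-algebra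 generated by a universal Kumjian-Pask $\Lambda$-family $(p,s)$ (the free $R$-algebra on $\Lambda^0\cup\Lambda^{\neq0}\cup G(\Lambda^{\neq0})$ modulo the relations (KP1)-(KP4)). It is $\mathbb{Z}^k$-graded by $\mathrm{KP}_R(\Lambda)_n=\mathrm{span}_R\{s_\lambda s_{\mu^*}:\lambda,\mu\in\Lambda,\ d(\lambda)-d(\mu)=n\}$, $n\in\mathbb{Z}^k$. An ideal $I$ of $\mathrm{KP}_R(\Lambda)$ is graded if $I=\bigoplus_{n\in\mathbb{Z}^k}(I\cap\mathrm{KP}_R(\Lambda)_n)$; it is basic if $rp_v\in I$ with $v\in\Lambda^0$ and $r\in R\setminus\{0\}$ implies $p_v\in I$. *)

(* Defs.v *)
From HB Require Import structures.
From mathcomp Require Import all_boot all_order all_algebra.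
From mathcomp Require Import all_classical.

Set Implicit Arguments.
Unset Strict Implicit.
Unset Printing Implicit Defensive.
Import Order.TTheory GRing.Theory Num.Theory.
Local Open Scope classical_set_scope.
Local Open Scope ring_scope.

(** * Lattices of sets ordered by inclusion *)

Section SetLattice.
Context {T U : Type}.

Definition is_inf_in (P : set (set T)) (A B C : set T) : Prop :=
  [/\ P C, C `<=` A, C `<=` B &
      forall D, P D -> D `<=` A -> D `<=` B -> D `<=` C].

Definition is_sup_in (P : set (set T)) (A B C : set T) : Prop :=
  [/\ P C, A `<=` C, B `<=` C &
      forall D, P D -> A `<=` D -> B `<=` D -> C `<=` D].

Definition is_set_lattice (P : set (set T)) : Prop :=
  forall A B, P A -> P B ->
    (exists C, is_inf_in P A B C) /\ (exists C, is_sup_in P A B C).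

End SetLattice.

Definition set_lattice_iso {T U : Type} (P : set (set T)) (Q : set (set U))
    (f : set T -> set U) : Prop :=
  [/\ is_set_lattice P, is_set_lattice Q, set_bij P Q f,
      (forall A B, P A -> P B -> (A `<=` B <-> f A `<=` f B)) &
      forall A B C, P A -> P B ->
        (is_inf_in P A B C -> is_inf_in Q (f A) (f B) (f C)) /\
        (is_sup_in P A B C -> is_sup_in Q (f A) (f B) (f C))].

(** * Algebras without identity *)

HB.mixin Record Lmodule_isNuAlgebra (R : comNzRingType) A
    of GRing.Lmodule R A := {
  numul : A -> A -> A;
  numulA : associative numul;
  numulDl : left_distributive numul +%R;
  numulDr : right_distributive numul +%R;
  nuscaleAl : forall (c : R) (x y : A), c *: numul x y = numul (c *: x) y;
  nuscaleAr : forall (c : R) (x y : A), c *: numul x y = numul x (c *: y)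
}.

#[short(type="nuAlgType")]
HB.structure Definition NuAlgebra (R : comNzRingType) :=
  { A of GRing.Lmodule R A & Lmodule_isNuAlgebra R A }.

Notation "x ** y" := (numul x y) (at level 40, left associativity) : ring_scope.

Section NuAlgebraTheory.
Variables (R : comNzRingType) (A : nuAlgType R).

Lemma nu0mul (a : A) : 0 ** a = 0.
Proof. by apply: (addrI (0 ** a)); rewrite -numulDl !addr0. Qed.

Lemma numul0 (a : A) : a ** 0 = 0.
Proof. by apply: (addrI (a ** 0)); rewrite -numulDr !addr0. Qed.

Lemma nusuml (I : Type) (s : seq I) (F : I -> A) (a : A) :
  (\sum_(i <- s) F i) ** a = \sum_(i <- s) (F i ** a).
Proof.
elim: s => [|i s IH]; first by rewrite !big_nil nu0mul.
by rewrite !big_cons numulDl IH.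
Qed.

Definition is_ideal (I : set A) : Prop :=
  [/\ I 0, (forall a b, I a -> I b -> I (a - b)),
      (forall a b, I b -> I (a ** b)) & (forall a b, I a -> I (a ** b))].

Definition ideal_gen (G : set A) : set A := smallest is_ideal G.

End NuAlgebraTheory.

Definition lspan {R : comNzRingType} {V : lmodType R} (G : set V) : set V :=
  [set v | exists (n : nat) (c : 'I_n -> R) (x : 'I_n -> V),
     (forall i, G (x i)) /\ v = \sum_(i < n) c i *: x i].

(* M is the internal direct sum of the (additive subgroups) N j *)
Definition is_direct_sum {J : choiceType} {V : zmodType}
    (M : set V) (N : J -> set V) : Prop :=
  let admissible (f : J -> V) :=
    finite_set [set j | f j != 0] /\ forall j, N j (f j) in
  (forall f, admissible f -> M (\sum_(j \in [set: J]) f j)) /\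
  (forall a, M a ->
     exists! f, admissible f /\ a = \sum_(j \in [set: J]) f j).

(** * Algebras presented by generators and relations *)

Inductive nuterm (R X : Type) : Type :=
| TGen of X
| TZero
| TOpp of nuterm R X
| TAdd of nuterm R X & nuterm R X
| TMul of nuterm R X & nuterm R X
| TScale of R & nuterm R X.
Arguments TGen {R X}.
Arguments TZero {R X}.
Arguments TOpp {R X}.
Arguments TAdd {R X}.
Arguments TMul {R X}.
Arguments TScale {R X}.

(* The smallest congruence which contains ax and makes the quotient an
   associative, not necessarily unital, R-algebra. *)
Inductive pres_eq (R : comNzRingType) (X : Type)
    (ax : nuterm R X -> nuterm R X -> Prop) :
    nuterm R X -> nuterm R X -> Prop :=
| pe_rel x y : ax x y -> pres_eq ax x y
| pe_refl x : pres_eq ax x x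
| pe_sym x y : pres_eq ax x y -> pres_eq ax y x
| pe_trans x y z : pres_eq ax x y -> pres_eq ax y z -> pres_eq ax x z
| pe_opp x x' : pres_eq ax x x' -> pres_eq ax (TOpp x) (TOpp x')
| pe_add x x' y y' : pres_eq ax x x' -> pres_eq ax y y' ->
    pres_eq ax (TAdd x y) (TAdd x' y')
| pe_mul x x' y y' : pres_eq ax x x' -> pres_eq ax y y' ->
    pres_eq ax (TMul x y) (TMul x' y')
| pe_scale c x x' : pres_eq ax x x' ->
    pres_eq ax (TScale c x) (TScale c x')
| pe_addA x y z : pres_eq ax (TAdd x (TAdd y z)) (TAdd (TAdd x y) z)
| pe_addC x y : pres_eq ax (TAdd x y) (TAdd y x)
| pe_add0 x : pres_eq ax (TAdd TZero x) x
| pe_addN x : pres_eq ax (TAdd (TOpp x) x) TZero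
| pe_scaleA c e x : pres_eq ax (TScale c (TScale e x)) (TScale (c * e) x)
| pe_scale1 x : pres_eq ax (TScale 1 x) x
| pe_scaleDr c x y :
    pres_eq ax (TScale c (TAdd x y)) (TAdd (TScale c x) (TScale c y))
| pe_scaleDl c e x :
    pres_eq ax (TScale (c + e) x) (TAdd (TScale c x) (TScale e x))
| pe_mulA x y z : pres_eq ax (TMul x (TMul y z)) (TMul (TMul x y) z)
| pe_mulDl x y z :
    pres_eq ax (TMul (TAdd x y) z) (TAdd (TMul x z) (TMul y z))
| pe_mulDr x y z :
    pres_eq ax (TMul x (TAdd y z)) (TAdd (TMul x y) (TMul x z))
| pe_scaleAl c x y : pres_eq ax (TScale c (TMul x y)) (TMul (TScale c x) y)
| pe_scaleAr c x y : pres_eq ax (TScale c (TMul x y)) (TMul x (TScale c y)).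

HB.instance Definition _ (R X : Type) := gen_eqMixin (nuterm R X).
HB.instance Definition _ (R X : Type) := gen_choiceMixin (nuterm R X).

Section Presented.
Variables (R : comNzRingType) (X : Type).
Variable ax : nuterm R X -> nuterm R X -> Prop.
Local Notation term := (nuterm R X).
Local Open Scope quotient_scope.

Definition pres_eqb : rel term := fun x y => `[< pres_eq ax x y >].

Lemma pres_eqb_equiv : equiv_class_of pres_eqb.
Proof.
split.
- by move=> x; apply/asboolP/pe_refl.
- by move=> x y; apply/asboolP/asboolP; apply: pe_sym.
- by move=> y x z /asboolP xy /asboolP yz; apply/asboolP/(pe_trans xy).
Qed.

Canonical pres_equiv := EquivRelPack pres_eqb_equiv.

Definition presented : Type := {eq_quot pres_equiv}.
HB.instance Definition _ := Choice.on presented.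
HB.instance Definition _ := Quotient.on presented.

Definition pres_pi (t : term) : presented := \pi_presented t.

Lemma pres_piP x y : pres_pi x = pres_pi y <-> pres_eq ax x y.
Proof.
split; first by move/eqmodP/asboolP.
by move=> xy; apply/eqmodP/asboolP.
Qed.

Lemma pres_reprP x : pres_eq ax (repr (pres_pi x)) x.
Proof. by apply/pres_piP; rewrite /pres_pi reprK. Qed.

Lemma pres_pi_surj (a : presented) : exists t, pres_pi t = a.
Proof. by exists (repr a); rewrite /pres_pi reprK. Qed.

Definition pres_gen (x : X) : presented := pres_pi (TGen x).
Definition pres_zero : presented := pres_pi TZero.
Definition pres_opp (a : presented) := pres_pi (TOpp (repr a)).
Definition pres_add (a b : presented) := pres_pi (TAdd (repr a) (repr b)).
Definition pres_mul (a b : presented) := pres_pi (TMul (repr a) (repr b)).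
Definition pres_scale (c : R) (a : presented) := pres_pi (TScale c (repr a)).

Lemma pres_oppE x : pres_opp (pres_pi x) = pres_pi (TOpp x).
Proof. by apply/pres_piP/pe_opp/pres_reprP. Qed.
Lemma pres_addE x y : pres_add (pres_pi x) (pres_pi y) = pres_pi (TAdd x y).
Proof. by apply/pres_piP/pe_add; apply: pres_reprP. Qed.
Lemma pres_mulE x y : pres_mul (pres_pi x) (pres_pi y) = pres_pi (TMul x y).
Proof. by apply/pres_piP/pe_mul; apply: pres_reprP. Qed.
Lemma pres_scaleE c x : pres_scale c (pres_pi x) = pres_pi (TScale c x).
Proof. by apply/pres_piP/pe_scale/pres_reprP. Qed.

Let presE := (pres_oppE, pres_addE, pres_mulE, pres_scaleE).

Lemma pres_addA : associative pres_add.
Proof.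
move=> a b c; case: (pres_pi_surj a) (pres_pi_surj b) (pres_pi_surj c).
by move=> x <- [y <-] [z <-]; rewrite !presE; apply/pres_piP/pe_addA.
Qed.
Lemma pres_addC : commutative pres_add.
Proof.
move=> a b; case: (pres_pi_surj a) (pres_pi_surj b) => x <- [y <-].
by rewrite !presE; apply/pres_piP/pe_addC.
Qed.
Lemma pres_add0 : left_id pres_zero pres_add.
Proof.
move=> a; case: (pres_pi_surj a) => x <-.
by rewrite !presE; apply/pres_piP/pe_add0.
Qed.
Lemma pres_addN : left_inverse pres_zero pres_opp pres_add.
Proof.
move=> a; case: (pres_pi_surj a) => x <-.
by rewrite !presE; apply/pres_piP/pe_addN.
Qed.

HB.instance Definition _ :=
  GRing.isZmodule.Build presented pres_addA pres_addC pres_add0 pres_addN.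

Lemma pres_scaleA c e a : pres_scale c (pres_scale e a) = pres_scale (c * e) a.
Proof.
case: (pres_pi_surj a) => x <-.
by rewrite !presE; apply/pres_piP/pe_scaleA.
Qed.
Lemma pres_scale1 : left_id 1 pres_scale.
Proof.
move=> a; case: (pres_pi_surj a) => x <-.
by rewrite !presE; apply/pres_piP/pe_scale1.
Qed.
Lemma pres_scaleDr : right_distributive pres_scale +%R.
Proof.
move=> c a b; case: (pres_pi_surj a) (pres_pi_surj b) => x <- [y <-].
by rewrite /GRing.add /= !presE; apply/pres_piP/pe_scaleDr.
Qed.
Lemma pres_scaleDl a : {morph pres_scale^~ a : c e / c + e}.
Proof.
move=> c e; case: (pres_pi_surj a) => x <-.
by rewrite [RHS]/GRing.add /= !presE; apply/pres_piP/pe_scaleDl.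
Qed.

HB.instance Definition _ := GRing.Zmodule_isLmodule.Build R presented
  pres_scaleA pres_scale1 pres_scaleDr pres_scaleDl.

Lemma pres_mulA : associative pres_mul.
Proof.
move=> a b c; case: (pres_pi_surj a) (pres_pi_surj b) (pres_pi_surj c).
by move=> x <- [y <-] [z <-]; rewrite !presE; apply/pres_piP/pe_mulA.
Qed.
Lemma pres_mulDl : left_distributive pres_mul +%R.
Proof.
move=> a b c; case: (pres_pi_surj a) (pres_pi_surj b) (pres_pi_surj c).
move=> x <- [y <-] [z <-]; rewrite /GRing.add /= !presE.
exact/pres_piP/pe_mulDl.
Qed.
Lemma pres_mulDr : right_distributive pres_mul +%R.
Proof.
move=> a b c; case: (pres_pi_surj a) (pres_pi_surj b) (pres_pi_surj c).
move=> x <- [y <-] [z <-]; rewrite /GRing.add /= !presE.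
exact/pres_piP/pe_mulDr.
Qed.
Lemma pres_scaleAl (c : R) (a b : presented) :
  c *: pres_mul a b = pres_mul (c *: a) b.
Proof.
case: (pres_pi_surj a) (pres_pi_surj b) => x <- [y <-].
by rewrite /GRing.scale /= !presE; apply/pres_piP/pe_scaleAl.
Qed.
Lemma pres_scaleAr (c : R) (a b : presented) :
  c *: pres_mul a b = pres_mul a (c *: b).
Proof.
case: (pres_pi_surj a) (pres_pi_surj b) => x <- [y <-].
by rewrite /GRing.scale /= !presE; apply/pres_piP/pe_scaleAr.
Qed.

HB.instance Definition _ := Lmodule_isNuAlgebra.Build R presented
  pres_mulA pres_mulDl pres_mulDr pres_scaleAl pres_scaleAr.

Lemma pres_pi0 : pres_pi TZero = 0. Proof. by []. Qed.
Lemma pres_piN x : pres_pi (TOpp x) = - pres_pi x.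
Proof. by rewrite /GRing.opp /= pres_oppE. Qed.
Lemma pres_piD x y : pres_pi (TAdd x y) = pres_pi x + pres_pi y.
Proof. by rewrite /GRing.add /= pres_addE. Qed.
Lemma pres_piM x y : pres_pi (TMul x y) = pres_pi x ** pres_pi y.
Proof. by rewrite /numul /= pres_mulE. Qed.
Lemma pres_piZ c x : pres_pi (TScale c x) = c *: pres_pi x.
Proof. by rewrite /GRing.scale /= pres_scaleE. Qed.

Lemma pres_pi_sum (I : Type) (s : seq I) (F : I -> term) :
  pres_pi (\big[TAdd/TZero]_(i <- s) F i) = \sum_(i <- s) pres_pi (F i).
Proof. by elim: s => [|i s IH]; rewrite ?big_nil // !big_cons pres_piD IH. Qed.

End Presented.

Fixpoint nueval {R : comNzRingType} {X : Type} {A : nuAlgType R} (f : X -> A)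
    (t : nuterm R X) : A :=
  match t with
  | TGen x => f x
  | TZero => 0
  | TOpp t => - nueval f t
  | TAdd t u => nueval f t + nueval f u
  | TMul t u => nueval f t ** nueval f u
  | TScale c t => c *: nueval f t
  end.

Lemma nueval_sum {R : comNzRingType} {X : Type} {A : nuAlgType R} (f : X -> A)
    (I : Type) (s : seq I) (F : I -> nuterm R X) :
  nueval f (\big[TAdd/TZero]_(i <- s) F i) = \sum_(i <- s) nueval f (F i).
Proof. by elim: s => [|i s IH]; rewrite ?big_nil // !big_cons /= IH. Qed.

Lemma pres_eq_eval {R : comNzRingType} {X : Type}
    (ax : nuterm R X -> nuterm R X -> Prop) {A : nuAlgType R} (f : X -> A) :
  (forall t u, ax t u -> nueval f t = nueval f u) ->
  forall t u, pres_eq ax t u -> nueval f t = nueval f u.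
Proof.
move=> fax t u; elim=> //=.
- by move=> x y z _ -> _ ->.
- by move=> x x' _ ->.
- by move=> x x' y y' _ -> _ ->.
- by move=> x x' y y' _ -> _ ->.
- by move=> c x x' _ ->.
- by move=> *; rewrite addrA.
- by move=> *; rewrite addrC.
- by move=> *; rewrite add0r.
- by move=> *; rewrite addNr.
- by move=> *; rewrite scalerA.
- by move=> *; rewrite scale1r.
- by move=> *; rewrite scalerDr.
- by move=> *; rewrite scalerDl.
- by move=> *; rewrite numulA.
- by move=> *; rewrite numulDl.
- by move=> *; rewrite numulDr.
- by move=> *; rewrite nuscaleAl.
- by move=> *; rewrite nuscaleAr.
Qed.

(** * k-graphs *)

(* kcomp is total; its value on a pair with src l <> rng m carries no
   information.  kcomp l m is the composite written "l m" with l after m. *)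
Record kgraph (k : nat) := KGraph {
  vertex : countType;
  kpath :> countType;
  vid : vertex -> kpath;
  src : kpath -> vertex;
  rng : kpath -> vertex;
  kcomp : kpath -> kpath -> kpath;
  deg : kpath -> 'rV[nat]_k;
  src_vid : forall v, src (vid v) = v;
  rng_vid : forall v, rng (vid v) = v;
  src_comp : forall l m, src l = rng m -> src (kcomp l m) = src m;
  rng_comp : forall l m, src l = rng m -> rng (kcomp l m) = rng l;
  comp_vidl : forall l, kcomp (vid (rng l)) l = l;
  comp_vidr : forall l, kcomp l (vid (src l)) = l;
  comp_assoc : forall l m n, src l = rng m -> src m = rng n ->
    kcomp l (kcomp m n) = kcomp (kcomp l m) n;
  deg_vid : forall v, deg (vid v) = 0;
  deg_comp : forall l m, src l = rng m -> deg (kcomp l m) = deg l + deg m;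
  factorization : forall l (m n : 'rV[nat]_k), deg l = m + n ->
    exists! mn : kpath * kpath,
      [/\ deg mn.1 = m, deg mn.2 = n, src mn.1 = rng mn.2 &
          l = kcomp mn.1 mn.2]
}.
Arguments vid {k _}.
Arguments src {k _}.
Arguments rng {k _}.
Arguments kcomp {k _}.
Arguments deg {k _}.

Section KGraph.
Variables (k : nat) (L : kgraph k).
Implicit Types (v : vertex L) (l m : L) (n : 'rV[nat]_k).

Definition paths_to v n : set L := [set l | rng l = v /\ deg l = n].

Definition row_finite : Prop := forall v n, finite_set (paths_to v n).

Definition no_sources : Prop := forall v n, paths_to v n !=set0.

Definition hereditary (H : set (vertex L)) : Prop :=
  forall l, H (rng l) -> H (src l).

Definition saturated (H : set (vertex L)) : Prop :=
  forall v n, src @` paths_to v n `<=` H -> H v.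

Lemma deg0_vid l : deg l = 0 -> l = vid (rng l).
Proof.
move=> dl; have [mn [_ uniq_mn]] : exists! mn : L * L,
    [/\ deg mn.1 = 0, deg mn.2 = 0, src mn.1 = rng mn.2 & l = kcomp mn.1 mn.2].
  by apply: factorization; rewrite dl addr0.
have e1 : mn = (vid (rng l), l).
  by apply: uniq_mn; rewrite /= deg_vid dl src_vid comp_vidl.
have e2 : mn = (l, vid (src l)).
  by apply: uniq_mn; rewrite /= deg_vid dl rng_vid comp_vidr.
by move: e2; rewrite e1 => -[].
Qed.

Definition nzpath : Type := {l : L | deg l != 0}.

Inductive kp_gen : Type :=
| GVertex of vertex L
| GPath of nzpath
| GGhost of nzpath.

(* The convention S_v := P_v =: S_{v^*}, vertices being identified with the
   paths of degree 0: for such a path l = vid (rng l). *)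
Definition path_gen l : kp_gen :=
  if insub l is Some l' then GPath l' else GVertex (rng l).
Definition ghost_gen l : kp_gen :=
  if insub l is Some l' then GGhost l' else GVertex (rng l).

Lemma path_gen_vid v : path_gen (vid v) = GVertex v.
Proof. by rewrite /path_gen insubN ?deg_vid ?eqxx // rng_vid. Qed.
Lemma ghost_gen_vid v : ghost_gen (vid v) = GVertex v.
Proof. by rewrite /ghost_gen insubN ?deg_vid ?eqxx // rng_vid. Qed.
Lemma path_gen_nz (l : nzpath) : path_gen (val l) = GPath l.
Proof. by rewrite /path_gen valK. Qed.
Lemma ghost_gen_nz (l : nzpath) : ghost_gen (val l) = GGhost l.
Proof. by rewrite /ghost_gen valK. Qed.

End KGraph.

Section KPFamily.
Variables (k : nat) (L : kgraph k) (R : comNzRingType) (A : nuAlgType R).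

(* F bundles the two functions P and S of a family (P, S). *)
Definition is_kp_family (F : kp_gen L -> A) : Prop :=
  let P v := F (GVertex v) in
  let S l := F (path_gen l) in
  let G l := F (ghost_gen l) in
  [/\ forall v w, P v ** P w = if v == w then P v else 0,
      (forall l m : L, deg l != 0 -> deg m != 0 -> rng m = src l ->
          S l ** S m = S (kcomp l m) /\ G m ** G l = G (kcomp l m)) /\
        (forall l : L, deg l != 0 ->
          [/\ P (rng l) ** S l = S l, S l ** P (src l) = S l,
              P (src l) ** G l = G l & G l ** P (rng l) = G l]),
      forall l m : L, deg l != 0 -> deg m != 0 -> deg l = deg m ->
          G l ** S m = if l == m then P (src l) else 0 &
      forall v (n : 'rV[nat]_k), n != 0 ->
          P v = \sum_(l \in paths_to v n) (S l ** G l)].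

End KPFamily.

(** * The Kumjian-Pask algebra *)

Section KumjianPask.
Variables (k : nat) (R : comNzRingType) (L : kgraph k).

Local Notation tP v := (TGen (GVertex v)).
Local Notation tS l := (TGen (path_gen l)).
Local Notation tG l := (TGen (ghost_gen l)).

(* In kp_4 the sequence e enumerates the finite set v L^n. *)
Inductive kp_rel : nuterm R (kp_gen L) -> nuterm R (kp_gen L) -> Prop :=
| kp_1_idem v : kp_rel (TMul (tP v) (tP v)) (tP v)
| kp_1_orth v w : v != w -> kp_rel (TMul (tP v) (tP w)) TZero
| kp_2_path (l m : L) : deg l != 0 -> deg m != 0 -> rng m = src l ->
    kp_rel (TMul (tS l) (tS m)) (tS (kcomp l m))
| kp_2_ghost (l m : L) : deg l != 0 -> deg m != 0 -> rng m = src l ->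
    kp_rel (TMul (tG m) (tG l)) (tG (kcomp l m))
| kp_2_rng_path (l : L) : deg l != 0 ->
    kp_rel (TMul (tP (rng l)) (tS l)) (tS l)
| kp_2_path_src (l : L) : deg l != 0 ->
    kp_rel (TMul (tS l) (tP (src l))) (tS l)
| kp_2_src_ghost (l : L) : deg l != 0 ->
    kp_rel (TMul (tP (src l)) (tG l)) (tG l)
| kp_2_ghost_rng (l : L) : deg l != 0 ->
    kp_rel (TMul (tG l) (tP (rng l))) (tG l)
| kp_3_eq (l : L) : deg l != 0 -> kp_rel (TMul (tG l) (tS l)) (tP (src l))
| kp_3_neq (l m : L) : deg l != 0 -> deg m != 0 -> deg l = deg m -> l != m ->
    kp_rel (TMul (tG l) (tS m)) TZero
| kp_4 v (n : 'rV[nat]_k) (e : seq L) : n != 0 ->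
    uniq e -> [set` e] = paths_to v n ->
    kp_rel (tP v) (\big[TAdd/TZero]_(l <- e) TMul (tS l) (tG l)).

Definition KP : Type := presented kp_rel.
HB.instance Definition _ := NuAlgebra.on KP.

Definition kp_fam (x : kp_gen L) : KP := pres_gen kp_rel x.
Definition kp_p (v : vertex L) : KP := kp_fam (GVertex v).
Definition kp_s (l : L) : KP := kp_fam (path_gen l).
Definition kp_g (l : L) : KP := kp_fam (ghost_gen l).

Lemma kp_relE t u : kp_rel t u -> pres_pi kp_rel t = pres_pi kp_rel u.
Proof. by move=> tu; apply/pres_piP/pe_rel. Qed.

Lemma kp_fam_family : row_finite L -> is_kp_family kp_fam.
Proof.
move=> rfL; split.
- move=> v w; rewrite -pres_piM; case: eqVneq => [<-|vw].
    exact/kp_relE/kp_1_idem.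
  exact/kp_relE/kp_1_orth.
- split=> [l m dl dm lm|l dl]; rewrite -!pres_piM; split; apply/kp_relE.
  + exact: kp_2_path.
  + exact: kp_2_ghost.
  + exact: kp_2_rng_path.
  + exact: kp_2_path_src.
  + exact: kp_2_src_ghost.
  + exact: kp_2_ghost_rng.
- move=> l m dl dm dlm; rewrite -pres_piM; case: eqVneq => [<-|lm].
    exact/kp_relE/kp_3_eq.
  exact/kp_relE/kp_3_neq.
- move=> v n n0; have fin := rfL v n.
  rewrite fsbig_finite //=.
  have enumE : [set` finmap.enum_fset (fset_set (paths_to v n))] = paths_to v n.
    by rewrite -[RHS](fset_setK fin).
  rewrite /kp_fam /pres_gen (kp_relE (kp_4 n0 (finmap.fset_uniq _) enumE)) pres_pi_sum.
  by apply: eq_bigr => l _; rewrite pres_piM.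
Qed.

Section Universal.
Variables (A : nuAlgType R) (F : kp_gen L -> A).
Hypothesis F_kp : is_kp_family F.

Lemma kp_rel_eval t u : kp_rel t u -> nueval F t = nueval F u.
Proof.
case: F_kp => kp1 [kp2 kp2'] kp3 kp4.
case=> /=.
- by move=> v; rewrite kp1 eqxx.
- by move=> v w /negPf vw; rewrite kp1 vw.
- by move=> l m dl dm lm; have [] := kp2 l m dl dm lm.
- by move=> l m dl dm lm; have [] := kp2 l m dl dm lm.
- by move=> l /kp2' [].
- by move=> l /kp2' [].
- by move=> l /kp2' [].
- by move=> l /kp2' [].
- by move=> l dl; rewrite kp3 // eqxx.
- by move=> l m dl dm dlm /negPf lm; rewrite kp3 // lm.
- move=> v n e n0 ue eE; rewrite (kp4 v n n0) nueval_sum -eE.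
  by rewrite -fsbig_seq.
Qed.

Definition kp_lift (a : KP) : A := nueval F (repr a).

Lemma kp_lift_pi t : kp_lift (pres_pi kp_rel t) = nueval F t.
Proof. exact: (pres_eq_eval kp_rel_eval (pres_reprP _ _)). Qed.

Lemma kp_universal : exists! phi : KP -> A,
  [/\ {morph phi : a b / a + b}, (forall c, {morph phi : a / c *: a}),
      {morph phi : a b / a ** b} & forall x, phi (kp_fam x) = F x].
Proof.
exists kp_lift; split.
  split=> [a b|c a|a b|x]; last exact: kp_lift_pi.
  - case: (pres_pi_surj a) (pres_pi_surj b) => x <- [y <-].
    by rewrite -pres_piD !kp_lift_pi.
  - by case: (pres_pi_surj a) => x <-; rewrite -pres_piZ !kp_lift_pi.
  - case: (pres_pi_surj a) (pres_pi_surj b) => x <- [y <-].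
    by rewrite -pres_piM !kp_lift_pi.
move=> phi [phiD phiZ phiM phiF]; apply/funext => a.
have phi0 : phi 0 = 0 by rewrite -(scale0r 0) phiZ scale0r.
have phiN b : phi (- b) = - phi b by rewrite -scaleN1r phiZ scaleN1r.
case: (pres_pi_surj a) => t <-; rewrite kp_lift_pi.
elim: t => /= [x||t IH|t IHt u IHu|t IHt u IHu|c t IH].
- by rewrite -phiF.
- by rewrite pres_pi0 phi0.
- by rewrite pres_piN phiN IH.
- by rewrite pres_piD phiD IHt IHu.
- by rewrite pres_piM phiM IHt IHu.
- by rewrite pres_piZ phiZ IH.
Qed.

End Universal.

Definition kp_degree (n : 'rV[int]_k) : set KP :=
  lspan [set x | exists l m : L,
    map_mx Posz (deg l) - map_mx Posz (deg m) = n /\ x = kp_s l ** kp_g m].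

Definition graded_ideal (I : set KP) : Prop :=
  is_ideal I /\ is_direct_sum I (fun n => I `&` kp_degree n).

Definition basic_ideal (I : set KP) : Prop :=
  is_ideal I /\ forall v (r : R), r != 0 -> I (r *: kp_p v) -> I (kp_p v).

(* is_ideal does not ask for stability under R; for KP, which has local units,
   it is automatic. *)
Lemma kp_local_unit (a : KP) : exists s : seq (vertex L),
  forall e, uniq e -> {subset s <= e} -> (\sum_(v <- e) kp_p v) ** a = a.
Proof.
have kp1 v w : kp_p v ** kp_p w = if v == w then kp_p v else 0.
  rewrite -pres_piM; case: eqVneq => [<-|vw]; first exact/kp_relE/kp_1_idem.
  exact/kp_relE/kp_1_orth.
have unit_gen x : exists v, kp_p v ** kp_fam x = kp_fam x.
  case: x => [v|l|l].
  - by exists v; rewrite kp1 eqxx.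
  - exists (rng (val l)); rewrite -path_gen_nz -pres_piM.
    exact/kp_relE/kp_2_rng_path/(valP l).
  - exists (src (val l)); rewrite -ghost_gen_nz -pres_piM.
    exact/kp_relE/kp_2_src_ghost/(valP l).
case: (pres_pi_surj a) => t <-; elim: t => [x||t [s IH]|t [s IHt] u [s' IHu]|
    t [s IHt] u _|c t [s IH]].
- have [v vx] := unit_gen x; exists [:: v] => e ue /(_ v (mem_head _ _)) ve.
  rewrite -[pres_pi _ _]vx numulA nusuml (bigD1_seq v) //= kp1 eqxx.
  by rewrite big1 ?addr0 // => w /negPf wv; rewrite kp1 wv.
- by exists [::] => e _ _; rewrite pres_pi0 numul0.
- exists s => e ue se; rewrite pres_piN -scaleN1r.
  by rewrite -nuscaleAr IH.
- exists (s ++ s') => e ue se; rewrite pres_piD numulDr IHt ?IHu // => v vs.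
    by apply: se; rewrite mem_cat vs orbT.
  by apply: se; rewrite mem_cat vs.
- by exists s => e ue se; rewrite pres_piM numulA IHt.
- by exists s => e ue se; rewrite pres_piZ -nuscaleAr IH.
Qed.

Lemma kp_ideal_scale (I : set KP) (c : R) (a : KP) :
  is_ideal I -> I a -> I (c *: a).
Proof.
move=> [_ _ IM _] Ia; have [s sa] := kp_local_unit a.
rewrite -(sa (undup s)) ?undup_uniq //; last by move=> v; rewrite mem_undup.
by rewrite nuscaleAl; apply: IM.
Qed.

Definition kp_ideal_of (H : set (vertex L)) : set KP :=
  ideal_gen [set kp_p v | v in H].

End KumjianPask.

(* Main.v *)
(** Injectivity. A branching system for the k-graph L is a set X on which the
    paths act by partial injections so that, for every degree n, each point
    factors uniquely as (path of degree n) . (point); the functions X -> R then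
    carry a Kumjian-Pask family.  The infinite paths which avoid a hereditary
    set H form such a system.  The resulting representation kills I_H, while
    r p_v acts by r on the functions supported on the infinite paths with range
    v, and these exist when H is saturated and v is not in H.  So r p_v in I_H
    with r != 0 forces v in H.

    Grading. Letting s_l act on functions Z^k -> KP by multiplication and
    translation by d(l) separates the homogeneous components; hence their sum is
    direct, and an ideal generated by homogeneous elements is graded.

    Surjectivity. By (KP4) a homogeneous element a of a basic graded ideal I is
    a combination of distinct s_l s_m^* in which all m have the same degree, and
    so do all l.  By (KP3) s_l^* a s_m = r p_(s(l)), where r is the coefficient
    of s_l s_m^* in a; if r != 0 then p_(s(l)) is in I because I is basic.  So a
    lies in the ideal generated by the p_v in I. *)

From HB Require Import structures.
Require Import Defs.
From mathcomp Require Import all_boot all_order all_algebra.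
From mathcomp Require Import all_classical.

Set Implicit Arguments.
Unset Strict Implicit.
Unset Printing Implicit Defensive.
Import Order.TTheory GRing.Theory Num.Theory.
Local Open Scope classical_set_scope.
Local Open Scope ring_scope.

(** * Lattices of sets and their isomorphisms *)

(** The infimum is the intersection of the two sets, the supremum the intersection of all members of
    [P] that contain both. *)
Lemma closure_set_lattice {T : Type} (P : set (set T)) :
  (forall F : set (set T), F `<=` P -> P (\bigcap_(A in F) A)) ->
  is_set_lattice P.
Proof.
move=> Pcap A B PA PB; split.
  exists (\bigcap_(C in [set A; B]) C); split.
  - by apply: Pcap => _ [] ->.
  - by move=> x; apply; left.
  - by move=> x; apply; right.
  - by move=> D _ DA DB x Dx _ [] ->; [apply: DA|apply: DB].
exists (\bigcap_(C in [set C | [/\ P C, A `<=` C & B `<=` C]]) C); split.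
- by apply: Pcap => C [].
- by move=> x Ax C [_ sAC _]; apply: sAC.
- by move=> x Bx C [_ _ sBC]; apply: sBC.
- by move=> D PD AD BD x; apply.
Qed.

(** Infima and suprema depend on the order alone, so an order isomorphism carries them over. In this
    way [Q] inherits its lattice structure from [P], and meets and joins of ideals need not be
    described. *)
Lemma set_lattice_iso_of_bij {T U : Type} (P : set (set T)) (Q : set (set U))
    (f : set T -> set U) :
  is_set_lattice P -> set_bij P Q f ->
  (forall A B, P A -> P B -> (A `<=` B <-> f A `<=` f B)) ->
  set_lattice_iso P Q f.
Proof.
move=> latP bijf le_f; have [fPQ _ fsurj] := bijf.
have surj D : Q D -> exists2 A, P A & f A = D by move=> /fsurj [A PA <-]; exists A.
have infP A B C : P A -> P B -> is_inf_in P A B C -> is_inf_in Q (f A) (f B) (f C).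
  move=> PA PB [PC CA CB Cmax]; split; [exact: fPQ|exact/le_f|exact/le_f|].
  move=> _ /surj [D PD <-] /(le_f _ _ PD PA) DA /(le_f _ _ PD PB) DB.
  by apply/le_f => //; apply: Cmax.
have supP A B C : P A -> P B -> is_sup_in P A B C -> is_sup_in Q (f A) (f B) (f C).
  move=> PA PB [PC CA CB Cmin]; split; [exact: fPQ|exact/le_f|exact/le_f|].
  move=> _ /surj [D PD <-] /(le_f _ _ PA PD) DA /(le_f _ _ PB PD) DB.
  by apply/le_f => //; apply: Cmin.
split=> //; last by move=> A B C PA PB; split; [apply: infP|apply: supP].
move=> _ _ /surj [A PA <-] /surj [B PB <-].
have [[C infC] [D supD]] := latP A B PA PB.
by split; [exists (f C); apply: infP | exists (f D); apply: supP].
Qed.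

(** * The algebra of linear endomorphisms of a module *)

Section Endomorphisms.
Variables (R : comNzRingType) (V : lmodType R).

Definition linear_pred : {pred V -> V} := fun f => `[< linear f >].

Lemma linear_pred_submod : submod_closed linear_pred.
Proof.
split; first by apply/asboolP => c x y; rewrite /GRing.zero /= scaler0 addr0.
move=> a f g; rewrite !unfold_in => /asboolW fL /asboolW gL.
apply/asboolP => c x y.
rewrite !fctE fL gL !scalerDr !scalerA (mulrC a c) -!addrA; congr (_ + _).
by rewrite addrCA.
Qed.
HB.instance Definition _ :=
  GRing.isSubmodClosed.Build R (V -> V) linear_pred linear_pred_submod.

(** A subtype of the function space, so that the module structure is inherited from the pointwise
    one on [V -> V]. With composition as product these are the target algebras of the
    representations below. *)
Record endo := Endo { endo_fun :> V -> V; endo_linear : linear_pred endo_fun }.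
HB.instance Definition _ := [isSub for endo_fun].
HB.instance Definition _ := [Choice of endo by <:].
HB.instance Definition _ := [SubChoice_isSubLmodule of endo by <:].

Lemma endoP (e : endo) c x y : e (c *: x + y) = c *: e x + e y.
Proof. by case: e => f fL /=; apply: (asboolW fL). Qed.

Lemma endoD (e : endo) x y : e (x + y) = e x + e y.
Proof. by rewrite -[x]scale1r endoP !scale1r. Qed.

Lemma endoZ (e : endo) c x : e (c *: x) = c *: e x.
Proof.
have e0 : e 0 = 0 by apply: (addrI (e 0)); rewrite -endoD !addr0.
by rewrite -[c *: x]addr0 endoP e0 addr0.
Qed.

Lemma endo_eq (e e' : endo) : e =1 e' -> e = e'.
Proof. by move=> ee'; apply/val_inj/funext. Qed.

Lemma endo_comp_subproof (e e' : endo) : linear_pred (e \o e').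
Proof. by apply/asboolP => c x y; rewrite /= !endoP. Qed.
Definition endo_comp e e' := Endo (endo_comp_subproof e e').

Lemma endoDE (e e' : endo) x : (e + e') x = e x + e' x. Proof. by []. Qed.
Lemma endoZE c (e : endo) x : (c *: e) x = c *: e x. Proof. by []. Qed.

Fact endo_compA : associative endo_comp.
Proof. by move=> e e' e''; apply: endo_eq. Qed.
Fact endo_compDl : left_distributive endo_comp +%R.
Proof. by move=> e e' e''; apply: endo_eq. Qed.
Fact endo_compDr : right_distributive endo_comp +%R.
Proof.
by move=> e e' e''; apply: endo_eq => x; apply: endoD.
Qed.
Fact endo_scaleAl c (e e' : endo) : c *: endo_comp e e' = endo_comp (c *: e) e'.
Proof. exact: endo_eq. Qed.
Fact endo_scaleAr c (e e' : endo) : c *: endo_comp e e' = endo_comp e (c *: e').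
Proof.
by apply: endo_eq => x; rewrite [RHS]endoZ.
Qed.
HB.instance Definition _ := Lmodule_isNuAlgebra.Build R endo
  endo_compA endo_compDl endo_compDr endo_scaleAl endo_scaleAr.

Lemma endoME (e e' : endo) x : (e ** e') x = e (e' x). Proof. by []. Qed.

Lemma endo_sumE I (s : seq I) (E : I -> endo) x :
  (\sum_(i <- s) E i) x = \sum_(i <- s) E i x.
Proof. by elim: s => [|i s IH]; rewrite ?big_nil // !big_cons endoDE IH. Qed.

End Endomorphisms.

(** * Ideals of algebras without identity *)

Section Ideals.
Variables (R : comNzRingType) (A : nuAlgType R).

Lemma ideal_gen_is_ideal (X : set A) : is_ideal (ideal_gen X).
Proof.
split.
- by move=> J [[]].
- by move=> a b Ia Ib J JX; have [[_ JB _ _] _] := JX; apply: JB; [apply: Ia|apply: Ib].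
- by move=> a b Ib J JX; have [[_ _ JM _] _] := JX; apply: JM; apply: Ib.
- by move=> a b Ia J JX; have [[_ _ _ JM] _] := JX; apply: JM; apply: Ia.
Qed.

Lemma idealD (I : set A) a b : is_ideal I -> I a -> I b -> I (a + b).
Proof.
by move=> [I0 IB _ _] Ia Ib; rewrite -[b]opprK; apply: (IB) => //; rewrite -sub0r; apply: IB.
Qed.

Lemma ideal_sum (I : set A) (J : eqType) (s : seq J) (F : J -> A) : is_ideal I ->
  (forall j, j \in s -> I (F j)) -> I (\sum_(j <- s) F j).
Proof.
move=> idI IF; rewrite big_seq; elim/big_ind: _ => //; first by case: idI.
by move=> a b; apply: idealD.
Qed.

End Ideals.

(** * Kumjian-Pask families *)

Section PathFamily.
Variables (k : nat) (L : kgraph k) (R : comNzRingType) (A : nuAlgType R).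

(* The Kumjian-Pask relations with vertices treated as paths of degree 0. *)
Definition path_family (S G : L -> A) : Prop :=
  [/\ forall v, G (vid v) = S (vid v),
      forall v w, v != w -> S (vid v) ** S (vid w) = 0,
      forall l m, src l = rng m ->
        S l ** S m = S (kcomp l m) /\ G m ** G l = G (kcomp l m),
      forall l m, deg l = deg m ->
        G l ** S m = if l == m then S (vid (src l)) else 0 &
      forall v n, S (vid v) = \sum_(l \in paths_to v n) (S l ** G l)].

Definition family_of (S G : L -> A) (x : kp_gen L) : A :=
  match x with
  | GVertex v => S (vid v)
  | GPath l => S (val l)
  | GGhost l => G (val l)
  end.

Lemma family_of_path S G l : family_of S G (path_gen l) = S l.
Proof.
have [dl|dl] := eqVneq (deg l) 0.
  by rewrite (deg0_vid dl) path_gen_vid.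
by rewrite /path_gen insubT.
Qed.

Lemma family_of_ghost S G l : (forall v, G (vid v) = S (vid v)) ->
  family_of S G (ghost_gen l) = G l.
Proof.
move=> GS; have [dl|dl] := eqVneq (deg l) 0.
  by rewrite (deg0_vid dl) ghost_gen_vid /= GS.
by rewrite /ghost_gen insubT.
Qed.

Lemma family_of_kp S G : path_family S G -> is_kp_family (family_of S G).
Proof.
move=> [GS orthS compSG mulGS sumSG].
have SS l m e : src l = rng m -> kcomp l m = e -> S l ** S m = S e.
  by move=> /compSG [-> _] ->.
have GG l m e : src l = rng m -> kcomp l m = e -> G m ** G l = G e.
  by move=> /compSG [_ ->] ->.
have pE := family_of_path S G; have gE l := @family_of_ghost S G l GS.
split=> /=.
- move=> v w; case: eqVneq => [<-|/orthS //].
  by apply: SS; rewrite ?src_vid ?rng_vid // -{1}(rng_vid v) comp_vidl.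
- split=> [l m _ _ ml|l _]; rewrite !pE !gE; first exact: compSG.
  split; [apply: SS|apply: SS|rewrite -GS; apply: GG|rewrite -GS; apply: GG];
    by rewrite ?src_vid ?rng_vid ?comp_vidl ?comp_vidr.
- by move=> l m _ _ /mulGS; rewrite pE gE.
- move=> v n _; rewrite (sumSG v n).
  by apply: eq_fsbigr => l _; rewrite pE gE.
Qed.

Lemma paths_to0 v : paths_to (L := L) v 0 = [set vid v].
Proof.
apply/seteqP; split=> [l [<- /deg0_vid]|_ ->]; first by [].
by split; rewrite ?rng_vid ?deg_vid.
Qed.

(** A path of degree 0 is an identity, so the extra composition and product relations reduce to
    (KP1) and to the unit relations in (KP2). In degree 0 the sum of (KP4) has the single term p_v
    p_v. *)
Lemma kp_family_path F : is_kp_family F ->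
  path_family (fun l : L => F (path_gen l) : A) (fun l : L => F (ghost_gen l)).
Proof.
move=> [orthP [compSG unitSG] mulGS sumSG].
have PP v : F (GVertex v) ** F (GVertex v) = F (GVertex v).
  by rewrite orthP eqxx.
split.
- by move=> v; rewrite path_gen_vid ghost_gen_vid.
- by move=> v w /negPf vw; rewrite !path_gen_vid orthP vw.
- move=> l m lm.
  have [dl|dl] := eqVneq (deg l) 0.
    have lE := deg0_vid dl; move: lm; rewrite lE src_vid => ->.
    rewrite comp_vidl path_gen_vid ghost_gen_vid.
    have [dm|dm] := eqVneq (deg m) 0; last by have [] := unitSG m dm.
    by rewrite (deg0_vid dm) rng_vid path_gen_vid ghost_gen_vid PP.
  have [dm|dm] := eqVneq (deg m) 0; last by apply: compSG.
  have mE := deg0_vid dm; rewrite mE -lm comp_vidr path_gen_vid ghost_gen_vid.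
  by have [] := unitSG l dl.
- move=> l m dlm; rewrite path_gen_vid.
  have [dl|dl] := eqVneq (deg l) 0; last by apply: mulGS; rewrite -?dlm.
  have lE := deg0_vid dl; have mE : m = vid (rng m) by apply: deg0_vid; rewrite -dlm.
  rewrite lE mE path_gen_vid ghost_gen_vid orthP src_vid.
  case: (eqVneq (rng l)) => [->|lm]; first by rewrite eqxx.
  by case: eqP => // /(congr1 rng); rewrite !rng_vid => /eqP; rewrite (negPf lm).
- move=> v n; rewrite path_gen_vid.
  have [->|n0] := eqVneq n 0; last exact: sumSG.
  by rewrite paths_to0 fsbig_set1 path_gen_vid ghost_gen_vid PP.
Qed.

End PathFamily.

Lemma endo_fsbigE (R : comNzRingType) (V : lmodType R) (I : choiceType)
    (D : set I) (E : I -> endo V) x : finite_set D ->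
  (\sum_(i \in D) E i) x = \sum_(i \in D) E i x.
Proof. by move=> Dfin; rewrite !fsbig_finite // endo_sumE. Qed.

(** * Linear spans *)

Section Span.
Variables (R : comNzRingType) (V : lmodType R).
Implicit Types (D : set V).

Lemma lspan_ind D (P : V -> Prop) : P 0 ->
  (forall c x v, D x -> P v -> P (c *: x + v)) -> forall v, lspan D v -> P v.
Proof.
move=> P0 PS v [n [c [x [Dx ->]]]]; elim: n c x Dx => [|n IH] c x Dx.
  by rewrite big_ord0.
by rewrite big_ord_recl; apply: PS => //; apply: IH.
Qed.

Lemma lspan0 D : lspan D 0.
Proof. by exists 0%N, (fun=> 0), (fun=> 0); split=> [[]|] //; rewrite big_ord0. Qed.

Lemma lspan_step D c x v : D x -> lspan D v -> lspan D (c *: x + v).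
Proof.
move=> Dx [n [e [y [Dy ->]]]].
exists n.+1, (fun i => oapp e c (unlift ord0 i)), (fun i => oapp y x (unlift ord0 i)).
split=> [i|]; first by case: unliftP => [j|] _; [apply: Dy|apply: Dx].
rewrite big_ord_recl unlift_none /=; congr (_ + _).
by apply: eq_bigr => i _; rewrite liftK.
Qed.

Lemma lspan_mem D x : D x -> lspan D x.
Proof. by move=> Dx; rewrite -[x]scale1r -[_ *: _]addr0; apply/lspan_step/lspan0. Qed.

Lemma lspanD D v w : lspan D v -> lspan D w -> lspan D (v + w).
Proof.
move=> Dv Dw; elim/lspan_ind: Dv => [|c x u Dx Du]; first by rewrite add0r.
by rewrite -addrA; apply: lspan_step.
Qed.

Lemma lspanZ D c v : lspan D v -> lspan D (c *: v).
Proof.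
elim/lspan_ind => [|e x u Dx Du]; first by rewrite scaler0; apply: lspan0.
by rewrite scalerDr scalerA; apply: lspan_step.
Qed.

Lemma lspanB D v w : lspan D v -> lspan D w -> lspan D (v - w).
Proof. by move=> Dv Dw; rewrite -scaleN1r; apply/lspanD/lspanZ. Qed.

Lemma lspan_fsbig D (I : choiceType) (E : set I) (F : I -> V) : finite_set E ->
  (forall i, E i -> lspan D (F i)) -> lspan D (\sum_(i \in E) F i).
Proof.
move=> Efin DF; rewrite fsbig_finite // big_seq.
elim/big_ind: _ => [|v w|i]; [exact: lspan0|exact: lspanD|].
by rewrite in_fset_set // inE; apply: DF.
Qed.

(** Repeated indices are merged by adding their coefficients. Distinct indices are what later allows
    a single coefficient to be isolated. *)
Lemma lspan_image (I : eqType) (D : set I) (x : I -> V) v : lspan (x @` D) v ->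
  exists (e : seq I) (c : I -> R), [/\ uniq e, forall i, i \in e -> D i &
    v = \sum_(i <- e) c i *: x i].
Proof.
elim/lspan_ind => [|a _ w [i Di <-] [e [c [ue De ->]]]].
  by exists [::], (fun=> 0); rewrite big_nil.
have [ie|ie] := boolP (i \in e).
  exists e, (fun j => if j == i then a + c i else c j); split=> //.
  rewrite !(bigD1_seq i ie ue) /= eqxx scalerDl -addrA; congr (_ + (_ + _)).
  by apply: eq_bigr => j /negPf ->.
exists (i :: e), (fun j => if j == i then a else c j); split=> /=.
- by rewrite ie.
- by move=> j; rewrite inE => /predU1P [->|/De].
- rewrite big_cons eqxx; congr (_ + _); apply: eq_big_seq => j je.
  by case: eqVneq je => // ->; rewrite (negPf ie).
Qed.

End Span.

Lemma fsbigT_seq (J : choiceType) (V : zmodType) (f : J -> V) (s : seq J) :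
  uniq s -> (forall j, j \notin s -> f j = 0) ->
  \sum_(j \in [set: J]) f j = \sum_(j <- s) f j.
Proof.
move=> us f0; rewrite (fsbigE s) // => [|j _]; last exact: f0.
by apply: eq_bigl => j; rewrite in_setT.
Qed.

(** * Decompositions into homogeneous components *)

Section DirectSum.
Variables (J : choiceType) (V : zmodType) (N : J -> set V).
Hypothesis N0 : forall j, N j 0.
Hypothesis NB : forall j a b, N j a -> N j b -> N j (a - b).

Definition decomposition (a : V) (f : J -> V) : Prop :=
  (finite_set [set j | f j != 0] /\ forall j, N j (f j)) /\
  a = \sum_(j \in [set: J]) f j.

Lemma finite_support_seq (f : J -> V) : finite_set [set j | f j != 0] ->
  exists s : seq J, forall j, j \notin s -> f j = 0.
Proof.
move=> fin; exists (finmap.enum_fset (fset_set [set j | f j != 0])) => j.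
by rewrite in_fset_set // notin_setE /= => /negP; rewrite negbK => /eqP.
Qed.

Lemma decompositionB a b f g : decomposition a f -> decomposition b g ->
  decomposition (a - b) (fun j => f j - g j).
Proof.
move=> [[ffin Nf] ->] [[gfin Ng] ->].
have [s f0] := finite_support_seq ffin; have [t g0] := finite_support_seq gfin.
set u := undup (s ++ t); have uu : uniq u by apply: undup_uniq.
have fu j : j \notin u -> f j = 0.
  by rewrite mem_undup mem_cat negb_or => /andP [/f0].
have gu j : j \notin u -> g j = 0.
  by rewrite mem_undup mem_cat negb_or => /andP [_ /g0].
have fgu j : j \notin u -> f j - g j = 0.
  by move=> ju; rewrite fu // gu // subr0.
split; last by rewrite !(fsbigT_seq uu) // sumrB.
split=> [|j]; last exact: NB.
apply: (@sub_finite_set _ _ [set` u]); last exact: finite_seq.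
by move=> j /=; apply: contraNT => /fgu ->.
Qed.

Lemma decomposition0 : decomposition 0 (fun=> 0).
Proof.
split; last by rewrite fsbig1.
by split=> //; apply: (@sub_finite_set _ _ set0) => // j /=; rewrite eqxx.
Qed.

Lemma decomposition_homogeneous i a : N i a ->
  decomposition a (fun j => if j == i then a else 0).
Proof.
move=> Na; split.
  split=> [|j]; last by case: eqP => [->|].
  apply: (@sub_finite_set _ _ [set i]); last exact: finite_set1.
  by move=> j /=; case: (j =P i) => // _; rewrite eqxx.
rewrite (@fsbigT_seq _ _ _ [:: i]) //; first by rewrite big_seq1 eqxx.
by move=> j; rewrite inE => /negPf ->.
Qed.

Definition decomposable (a : V) : Prop := exists f, decomposition a f.

Lemma decomposableB a b : decomposable a -> decomposable b -> decomposable (a - b).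
Proof. by move=> [f df] [g dg]; eexists; apply: decompositionB df dg. Qed.

Lemma decomposableD a b : decomposable a -> decomposable b -> decomposable (a + b).
Proof.
move=> da db; rewrite -[b]opprK; apply: decomposableB => //; rewrite -sub0r.
by apply: decomposableB => //; eexists; apply: decomposition0.
Qed.

Lemma decomposable_homogeneous i a : N i a -> decomposable a.
Proof. by move=> Na; eexists; apply: decomposition_homogeneous Na. Qed.

(** An induction principle that reduces additive properties to homogeneous elements. *)
Lemma decomposable_sum a (P : V -> Prop) : P 0 ->
  (forall a b, P a -> P b -> P (a + b)) -> (forall j a, N j a -> P a) ->
  decomposable a -> P a.
Proof.
move=> P0 PD PN [f [[fin Nf] ->]]; have [s f0] := finite_support_seq fin.
rewrite (@fsbigT_seq _ _ _ (undup s)) ?undup_uniq // => [|j]; last first.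
  by rewrite mem_undup; apply: f0.
by elim/big_ind: _ => // j _; apply: PN (Nf j).
Qed.

(* T plays the role of the projection onto the j-th component. *)
Lemma decomposition_proj (T : V -> V) j a f : {morph T : x y / x + y} ->
  (forall i b, i != j -> N i b -> T b = 0) -> decomposition a f -> T a = T (f j).
Proof.
move=> TD TN [[fin Nf] ->]; have [s f0] := finite_support_seq fin.
have T0 : T 0 = 0 by apply: (addrI (T 0)); rewrite -TD !addr0.
rewrite (@fsbigT_seq _ _ _ (undup (j :: s))) ?undup_uniq // => [|i]; last first.
  by rewrite mem_undup inE negb_or => /andP [_ /f0].
rewrite (big_morph T TD T0) (bigD1_seq j) ?undup_uniq ?mem_undup ?mem_head //=.
by rewrite big1 ?addr0 // => i ij; apply: TN (Nf i).
Qed.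

(** Two decompositions of the same element differ by a decomposition of 0, so uniqueness has to be
    tested at 0 only. *)
Lemma direct_sum_of_decomposable (M : set V) :
  M 0 -> (forall a b, M a -> M b -> M (a - b)) ->
  (forall j a, N j a -> M a) -> (forall a, M a -> decomposable a) ->
  (forall f, decomposition 0 f -> forall j, f j = 0) ->
  is_direct_sum M N.
Proof.
move=> M0 MB NM Mdec indep; split=> [f fadm|a /Mdec [f fa]].
  apply: (decomposable_sum M0 _ NM); last by exists f.
  by move=> a b Ma Mb; rewrite -[b]opprK; apply: (MB) => //; rewrite -sub0r; apply: MB.
exists f; split=> // g ga; apply/funext => j; apply/subr0_eq.
apply: (indep (fun j => f j - g j)); rewrite -(subrr a).
exact: decompositionB.
Qed.

End DirectSum.

(** * Consequences of the Kumjian-Pask relations *)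

Section FamilyTheory.
Variables (k : nat) (L : kgraph k) (R : comNzRingType) (A : nuAlgType R).
Variables (S G : L -> A).
Hypotheses (L_rf : row_finite L) (SG : path_family S G).

Lemma family_vv v w : S (vid v) ** S (vid w) = if v == w then S (vid v) else 0.
Proof.
case: SG => _ orthS comp _ _; case: eqVneq => [<-|/orthS //].
have [|-> _] := comp (vid v) (vid v); first by rewrite src_vid rng_vid.
by rewrite -{1}(rng_vid v) comp_vidl.
Qed.

Lemma family_rngS l : S (vid (rng l)) ** S l = S l.
Proof. by case: SG => _ _ /(_ (vid (rng l)) l (src_vid _)) [-> _]; rewrite comp_vidl. Qed.

Lemma family_Ssrc l : S l ** S (vid (src l)) = S l.
Proof.
by case: SG => _ _ /(_ l (vid (src l)) (esym (rng_vid _))) [-> _]; rewrite comp_vidr.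
Qed.

Lemma family_srcG l : S (vid (src l)) ** G l = G l.
Proof.
case: SG => GS _ /(_ l (vid (src l)) (esym (rng_vid _))) [_].
by rewrite GS comp_vidr.
Qed.

Lemma family_Grng l : G l ** S (vid (rng l)) = G l.
Proof.
case: SG => GS _ /(_ (vid (rng l)) l (src_vid _)) [_].
by rewrite GS comp_vidl.
Qed.

Lemma familyG_vid v : G (vid v) = S (vid v).
Proof. by case: SG. Qed.

(** For paths that do not compose, the product contains two distinct vertex idempotents side by
    side, and these are orthogonal. *)
Lemma family_SS l m : S l ** S m = if src l == rng m then S (kcomp l m) else 0.
Proof.
case: eqVneq => [lm|lm]; first by case: SG => _ _ /(_ l m lm) [].
rewrite -(family_Ssrc l) -(family_rngS m) numulA -(numulA (S l)) family_vv.
by rewrite (negPf lm) numul0 nu0mul.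
Qed.

Lemma family_GG l m : G m ** G l = if src l == rng m then G (kcomp l m) else 0.
Proof.
case: eqVneq => [lm|lm]; first by case: SG => _ _ /(_ l m lm) [].
rewrite -(family_Grng m) -(family_srcG l) numulA -(numulA (G m)) family_vv.
by rewrite eq_sym (negPf lm) numul0 nu0mul.
Qed.

Lemma family_SG_neq l m : src l != src m -> S l ** G m = 0.
Proof.
move=> lm; rewrite -(family_Ssrc l) -(family_srcG m) numulA -(numulA (S l)).
by rewrite family_vv (negPf lm) numul0 nu0mul.
Qed.

Lemma family_GS l m : deg l = deg m ->
  G l ** S m = if l == m then S (vid (src l)) else 0.
Proof. by case: SG => _ _ _ GS _; apply: GS. Qed.

Lemma nufsuml (I : choiceType) (D : set I) (F : I -> A) a : finite_set D ->
  (\sum_(i \in D) F i) ** a = \sum_(i \in D) (F i ** a).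
Proof. by move=> Dfin; rewrite !fsbig_finite // nusuml. Qed.

Lemma nufsumr (I : choiceType) (D : set I) (F : I -> A) a : finite_set D ->
  a ** (\sum_(i \in D) F i) = \sum_(i \in D) (a ** F i).
Proof.
move=> Dfin; rewrite !fsbig_finite //.
by rewrite (big_morph (numul a) (numulDr a) (numul0 a)).
Qed.

(** Insert the degree [n] case of (KP4) at the common source. Both paths grow by the same [u], so
    the difference of their degrees is kept. *)
Lemma family_expand l m n : src l = src m ->
  S l ** G m = \sum_(u \in paths_to (src l) n) (S (kcomp l u) ** G (kcomp m u)).
Proof.
move=> lm; have fin := L_rf (src l) n; rewrite -{1}(family_Ssrc l).
have /(_ (src l) n) -> : forall v n, S (vid v) = \sum_(u \in paths_to v n) (S u ** G u).
  by case: SG.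
rewrite nufsumr // nufsuml //; apply: eq_fsbigr => u; rewrite inE => -[ul _].
by rewrite numulA family_SS ul eqxx -numulA family_GG -lm ul eqxx.
Qed.

End FamilyTheory.

(** * Degrees in Z^k and products of homogeneous elements *)

Section Degree.
Variables (k : nat) (L : kgraph k).

Definition degz (l : L) : 'rV[int]_k := map_mx Posz (deg l).

Lemma degz_comp (l m : L) : src l = rng m -> degz (kcomp l m) = degz l + degz m.
Proof. by move=> lm; apply/rowP => i; rewrite !mxE deg_comp // mxE PoszD. Qed.

Lemma degz_vid v : degz (vid v) = 0.
Proof. by apply/rowP => i; rewrite !mxE deg_vid mxE. Qed.

Lemma degz_inj (l m : L) : degz l = degz m -> deg l = deg m.
Proof. by move=> /rowP lm; apply/rowP => i; have := lm i; rewrite !mxE => -[]. Qed.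

End Degree.

Section KPDegree.
Variables (k : nat) (R : comNzRingType) (L : kgraph k).
Hypothesis L_rf : row_finite L.
Local Notation KPA := (KP R L).
Local Notation S := (@kp_s k R L).
Local Notation G := (@kp_g k R L).
Local Notation p := (@kp_p k R L).
Local Notation kpdeg := (@kp_degree k R L).

Lemma kp_path_family : path_family S G.
Proof. exact/kp_family_path/kp_fam_family. Qed.
Local Notation fam := kp_path_family.

Lemma kp_s_vid v : S (vid v) = p v.
Proof. by rewrite /kp_s path_gen_vid. Qed.

Lemma kp_degree_SG l m : kpdeg (degz l - degz m) (S l ** G m).
Proof. by apply: lspan_mem; exists l, m. Qed.

Lemma kp_degree_gen x : exists n, kpdeg n (kp_fam R x).
Proof.
case: x => [v|l|l].
- exists (degz (vid v) - degz (vid v)).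
  have := kp_degree_SG (vid v) (vid v).
  by rewrite (familyG_vid fam) (family_vv fam) eqxx kp_s_vid.
- exists (degz (val l) - degz (vid (src (val l)))).
  have := kp_degree_SG (val l) (vid (src (val l))).
  by rewrite (familyG_vid fam) (family_Ssrc fam) /kp_s path_gen_nz.
- exists (degz (vid (src (val l))) - degz (val l)).
  have := kp_degree_SG (vid (src (val l))) (val l).
  by rewrite (family_srcG fam) /kp_g ghost_gen_nz.
Qed.

(** Expand p_(s(m)) in degree d(l), so that s_m is a sum of terms s_(mu) s_u^* with d(u) = d(l).
    Then mu factors as bc with d(b) = d(l), and (KP3) leaves s_c s_u^* if b = l and 0 otherwise.
    From d(m) + d(u) = d(b) + d(c) the degree d(c) - d(u) is d(m) - d(l). *)
Lemma kp_degree_GS l m : kpdeg (degz m - degz l) (G l ** S m).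
Proof.
rewrite -(family_Ssrc fam m) -(familyG_vid fam (src m)).
rewrite (family_expand L_rf fam (deg l)) ?src_vid // nufsumr; last exact: L_rf.
apply: lspan_fsbig => [|u [um du]]; first exact: L_rf.
rewrite -um comp_vidl.
have : deg (kcomp m u) = deg l + deg m by rewrite deg_comp // du addrC.
case/factorization => -[b c] [] /= [db dc bc mubc] _.
rewrite mubc -[S (kcomp b c)]/(S _).
have -> : S (kcomp b c) = S b ** S c by rewrite (family_SS fam) bc eqxx.
rewrite numulA numulA (family_GS fam) //; case: eqVneq => [lb|_]; last first.
  by rewrite !nu0mul; apply: lspan0.
rewrite lb bc (family_rngS fam) (_ : degz m - _ = degz c - degz u).
  exact: kp_degree_SG.
have : degz (kcomp m u) = degz (kcomp b c) by rewrite mubc.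
rewrite !degz_comp // -lb (_ : degz u = degz l); last by rewrite /degz du.
by rewrite addrC => /addrI ->.
Qed.

Lemma kp_degree_SmulG l m n a : kpdeg n a ->
  kpdeg (degz l + n - degz m) (S l ** a ** G m).
Proof.
elim/lspan_ind => [|c x v [b [d [<- ->]]] IH].
  by rewrite numul0 nu0mul; apply: lspan0.
rewrite numulDr numulDl -nuscaleAr -nuscaleAl; apply: lspanD IH; apply: lspanZ.
rewrite numulA -numulA (family_SS fam) (family_GG fam).
case: eqP => [lb|_]; last by rewrite nu0mul; apply: lspan0.
case: eqP => [md|_]; last by rewrite numul0; apply: lspan0.
rewrite (_ : degz l + _ - _ = degz (kcomp l b) - degz (kcomp m d)).
  exact: kp_degree_SG.
by rewrite !degz_comp // opprD !addrA [LHS]addrAC.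
Qed.

Lemma kp_degree_mul n n' a b : kpdeg n a -> kpdeg n' b -> kpdeg (n + n') (a ** b).
Proof.
elim/lspan_ind => [|c x v [l [m [<- ->]]] IH].
  by rewrite nu0mul => _; apply: lspan0.
move=> bn; rewrite numulDl -nuscaleAl; apply: lspanD (IH bn); apply: lspanZ.
elim/lspan_ind: bn => [|c' _ v' [l' [m' [<- ->]]] IHb].
  by rewrite numul0; apply: lspan0.
rewrite numulDr -nuscaleAr; apply: lspanD IHb; apply: lspanZ.
rewrite numulA -(numulA (S l)).
have := kp_degree_SmulG l m' (kp_degree_GS m l').
by rewrite -/(degz l) -/(degz m) -/(degz l') -/(degz m') !addrA (addrAC (degz l)).
Qed.

Lemma kp_degree0 n : kpdeg n 0. Proof. exact: lspan0. Qed.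
Lemma kp_degreeB n a b : kpdeg n a -> kpdeg n b -> kpdeg n (a - b).
Proof. exact: lspanB. Qed.

(** The decomposable elements form a subalgebra that contains the generators, whence the induction
    on a term representing [a]. *)
Lemma kp_decomposable (a : KPA) : decomposable kpdeg a.
Proof.
pose D := decomposable kpdeg.
have D0 : D 0 by exact: (decomposable_homogeneous kp_degree0 (kp_degree0 0)).
have DB x y : D x -> D y -> D (x - y).
  exact: (decomposableB kp_degreeB).
have DD x y : D x -> D y -> D (x + y).
  by move=> Dx Dy; rewrite -[y]opprK; apply: (DB) => //; rewrite -sub0r; apply: DB.
have [t <-] := pres_pi_surj a.
elim: t => [x||t IH|t IHt u IHu|t IHt u IHu|c t IH].
- by have [n xn] := kp_degree_gen x; apply: (decomposable_homogeneous kp_degree0 xn).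
- by rewrite pres_pi0.
- by rewrite pres_piN -sub0r; apply: DB.
- by rewrite pres_piD; apply: DD.
- rewrite pres_piM; elim/decomposable_sum: IHt => [|x y Dx Dy|n x xn].
  + by rewrite nu0mul.
  + by rewrite numulDl; apply: DD.
  + elim/decomposable_sum: IHu => [|y z Dy Dz|m y ym].
    * by rewrite numul0.
    * by rewrite numulDr; apply: DD.
    * exact: (decomposable_homogeneous kp_degree0 (kp_degree_mul xn ym)).
- rewrite pres_piZ; elim/decomposable_sum: IH => [|x y Dx Dy|n x xn].
  + by rewrite scaler0.
  + by rewrite scalerDr; apply: DD.
  + exact: (decomposable_homogeneous kp_degree0 (lspanZ c xn)).
Qed.

(** A right-hand counterpart of [kp_local_unit]: each term s_l s_m^* absorbs p_(r(m)) on the right.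
    It serves to recover a homogeneous component from its right multiples. *)
Lemma kp_local_unitr n a : kpdeg n a -> exists s : seq (vertex L),
  forall e, uniq e -> {subset s <= e} -> a ** (\sum_(v <- e) p v) = a.
Proof.
elim/lspan_ind => [|c _ v [l [m [_ ->]]] [s sv]].
  by exists [::] => e _ _; rewrite nu0mul.
exists (rng m :: s) => e ue se.
rewrite numulDl sv // => [|w ws]; last by apply: se; rewrite inE ws orbT.
congr (_ + _); rewrite -nuscaleAl -numulA -{1}(family_Grng fam m) kp_s_vid.
congr (c *: (S l ** _)); rewrite -numulA -[RHS](family_Grng fam m) kp_s_vid.
congr (_ ** _); have me : rng m \in e by apply: se; rewrite mem_head.
rewrite (big_morph (numul _) (numulDr _) (numul0 _)) (bigD1_seq _ me) //=.
rewrite big1 ?addr0 => [|w wm]; rewrite -!kp_s_vid (family_vv fam) ?eqxx //.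
by rewrite eq_sym (negPf wm).
Qed.

End KPDegree.

(** * The grading *)

Lemma kp_representation (k : nat) (R : comNzRingType) (L : kgraph k)
    (A : nuAlgType R) (S G : L -> A) : path_family S G ->
  exists phi : KP R L -> A,
    [/\ {morph phi : a b / a + b}, forall c, {morph phi : a / c *: a},
        {morph phi : a b / a ** b}, forall l, phi (kp_s R l) = S l &
        forall l, phi (kp_g R l) = G l].
Proof.
move=> SG; have [phi [[phiD phiZ phiM phiF] _]] := kp_universal (family_of_kp SG).
exists phi; split=> // l; rewrite phiF ?family_of_path ?family_of_ghost //.
by case: SG.
Qed.

Section Shift.
Variables (k : nat) (L : kgraph k) (R : comNzRingType) (A : nuAlgType R).
Local Notation V := ('rV[int]_k -> A).

Lemma shift_subproof (x : A) (d : 'rV[int]_k) :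
  linear_pred (fun (f : V) n => x ** f (n - d)).
Proof.
apply/asboolP => c f g; apply/funext => n.
by rewrite !fctE numulDr nuscaleAr.
Qed.
(** The monomial x t^d of the Laurent polynomials over [A] in k variables, acting on the [A]-valued
    functions on Z^k. *)
Definition shift_op x d : endo V := Endo (shift_subproof x d).

Lemma shift_opM x y d e : shift_op x d ** shift_op y e = shift_op (x ** y) (d + e).
Proof.
by apply: endo_eq => f; apply/funext => n /=; rewrite numulA opprD addrA.
Qed.

Lemma shift_op0 d : shift_op 0 d = 0.
Proof. by apply: endo_eq => f; apply/funext => n /=; rewrite nu0mul. Qed.

Lemma shift_opD d : {morph shift_op^~ d : x y / x + y}.
Proof. by move=> x y; apply: endo_eq => f; apply/funext => n /=; rewrite numulDl. Qed.

Lemma shift_opZ d c x : shift_op (c *: x) d = c *: shift_op x d.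
Proof. by apply: endo_eq => f; apply/funext => n /=; rewrite -nuscaleAl. Qed.

(** The translations respect the relations: degrees add along composites, and opposite translations
    cancel in (KP3) and (KP4). *)
Lemma shift_family (S G : L -> A) : row_finite L -> path_family S G ->
  path_family (fun l => shift_op (S l) (degz l)) (fun l => shift_op (G l) (- degz l)).
Proof.
move=> rf [GS orthS comp mulGS sumSG]; split.
- by move=> v; rewrite GS degz_vid oppr0.
- by move=> v w vw; rewrite shift_opM orthS // shift_op0.
- move=> l m lm; have [SE GE] := comp l m lm.
  by rewrite !shift_opM SE GE degz_comp // -opprD [degz m + _]addrC.
- move=> l m lm; rewrite shift_opM mulGS //.
  rewrite (_ : degz l = degz m); last by rewrite /degz lm.
  by case: eqP => _; rewrite ?shift_op0 // addNr degz_vid.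
- move=> v n; rewrite (sumSG v n) !fsbig_finite ?rf //.
  rewrite (big_morph _ (shift_opD _) (shift_op0 _)).
  by apply: eq_bigr => l _; rewrite shift_opM subrr degz_vid.
Qed.

End Shift.

Section KPGrading.
Variables (k : nat) (R : comNzRingType) (L : kgraph k).
Hypothesis L_rf : row_finite L.
Local Notation kpdeg := (@kp_degree k R L).

(** This replaces the projection onto degree [n], up to right multiplication by [b]. An element [a]
    of degree m sends the function with value [b] at 0 and 0 elsewhere to the one with value
    [a ** b] at m and 0 elsewhere; [T] reads off the value at [n]. *)
Lemma kp_component (n : 'rV[int]_k) (b : KP R L) : exists T : KP R L -> KP R L,
  {morph T : x y / x + y} /\
  forall m a, kpdeg m a -> T a = if m == n then a ** b else 0.
Proof.
have [phi [phiD phiZ phiM phiS phiG]] :=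
  kp_representation (shift_family L_rf (kp_path_family R L_rf)).
have phi_deg m a : kpdeg m a -> phi a = shift_op a m.
  elim/lspan_ind => [|c _ v [l [l' [<- ->]]] IH].
    by rewrite shift_op0 -(scale0r 0) phiZ scale0r.
  by rewrite phiD phiZ phiM phiS phiG IH shift_opD shift_opZ shift_opM.
exists (fun a => phi a (fun m => if m == 0 then b else 0) n); split=> [x y|m a ma].
  by rewrite phiD.
rewrite (phi_deg _ _ ma) /= subr_eq0 eq_sym; case: eqP => // _; exact: numul0.
Qed.

(** With [b] a right local unit of [f n], the map of [kp_component] sends the whole sum, which is 0,
    to [f n]. *)
Lemma kp_degree_independent f : decomposition kpdeg 0 f -> forall n, f n = 0.
Proof.
move=> f0 n; have [[_ Nf] _] := f0; have [s sf] := kp_local_unitr L_rf (Nf n).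
have us := undup_uniq s.
rewrite -[LHS](sf _ us) => [|v]; last by rewrite mem_undup.
have [T [TD TE]] := kp_component n (\sum_(v <- undup s) kp_p R v).
transitivity (T (f n)); first by rewrite (TE n) ?eqxx.
rewrite -(decomposition_proj TD _ f0) => [|m b mn mb]; last first.
  by rewrite (TE m) // (negPf mn).
by apply: (addrI (T 0)); rewrite -TD !addr0.
Qed.

Lemma kp_generated_graded (X : set (KP R L)) :
  (forall x, X x -> exists n, kpdeg n x) ->
  is_direct_sum (ideal_gen X) (fun n => ideal_gen X `&` kpdeg n).
Proof.
move=> Xhom; set I := ideal_gen X; set N := fun n => _.
have idI : is_ideal I by apply: ideal_gen_is_ideal.
have [I0 IB IM MI] := idI.
have N0 n : N n 0 by split=> //; apply: kp_degree0.
have NB n a b : N n a -> N n b -> N n (a - b).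
  by move=> [Ia na] [Ib nb]; split; [apply: IB|apply: kp_degreeB].
apply: direct_sum_of_decomposable => //.
- by move=> n a [].
(* The elements of [I] whose components lie in [I] again form an ideal containing [X], hence exhaust
   [I]. For the products the other factor is decomposed as well, by [kp_decomposable]. *)
- pose J a := I a /\ decomposable N a.
  suff IJ : I `<=` J by move=> a /IJ [].
  have J0 : J 0 by split=> //; apply: (decomposable_homogeneous N0 (N0 0)).
  have JD a b : J a -> J b -> J (a + b).
    move=> [Ia da] [Ib db]; split; first exact: (idealD idI).
    exact: (decomposableD N0 NB).
  have NJ n a : N n a -> J a.
    by move=> Na; split; [case: Na|apply: (decomposable_homogeneous N0 Na)].
  apply: smallest_sub; last first.
    by move=> x Xx; have [n xn] := Xhom x Xx; apply: (NJ n); split=> //; apply: sub_gen_smallest.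
  split=> //.
  + move=> a b [Ia da] [Ib db]; split; first exact: IB.
    exact: (decomposableB NB).
  + move=> a b [Ib db]; elim/decomposable_sum: db.
    * by rewrite numul0.
    * by move=> x y Jx Jy; rewrite numulDr; apply: JD.
    * move=> n x [Ix xn]; elim/decomposable_sum: (kp_decomposable L_rf a).
      - by rewrite nu0mul.
      - by move=> y z Jy Jz; rewrite numulDl; apply: JD.
      - move=> m y ym; apply: (NJ (m + n)).
        by split; [apply: IM|apply: kp_degree_mul].
  + move=> a b [Ia da]; elim/decomposable_sum: da.
    * by rewrite nu0mul.
    * by move=> x y Jx Jy; rewrite numulDl; apply: JD.
    * move=> n x [Ix xn]; elim/decomposable_sum: (kp_decomposable L_rf b).
      - by rewrite numul0.
      - by move=> y z Jy Jz; rewrite numulDr; apply: JD.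
      - move=> m y ym; apply: (NJ (n + m)).
        by split; [apply: MI|apply: kp_degree_mul].
- move=> f [[fin Nf] f0]; apply: kp_degree_independent; split=> //; split=> // n.
  by case: (Nf n).
Qed.

End KPGrading.

(** * Representations on branching systems *)

Section Branching.
Variables (k : nat) (L : kgraph k) (R : comNzRingType).
(** The points are the elements of [D]. A point x splits into its initial path [ini n x] of degree n
    and the rest [sh n x], and [act l y] puts l in front of y. Nothing is assumed of these maps
    outside [D]. *)
Variables (X : Type) (D : set X) (rg : X -> vertex L).
Variables (ini : 'rV[nat]_k -> X -> L) (sh : 'rV[nat]_k -> X -> X).
Variable act : L -> X -> X.
Hypothesis iniP : forall n x, D x ->
  [/\ D (sh n x), deg (ini n x) = n, src (ini n x) = rg (sh n x) &
      act (ini n x) (sh n x) = x].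
Hypothesis actP : forall l y, D y -> src l = rg y ->
  [/\ D (act l y), rg (act l y) = rng l, ini (deg l) (act l y) = l &
      sh (deg l) (act l y) = y].
Hypothesis act_vid : forall y, D y -> act (vid (rg y)) y = y.
Hypothesis act_comp : forall l m y, D y -> src l = rng m -> src m = rg y ->
  act (kcomp l m) y = act l (act m y).

Local Notation V := (X -> R^o).

(** The push-forward of functions along [act l], extended by 0; a point is in the image of [act l]
    exactly when its initial path of degree [deg l] is [l]. The ghost operator [branch_G] is the
    pull-back. *)
Lemma branch_S_subproof l :
  linear_pred (fun (f : V) x =>
    if `[< D x /\ ini (deg l) x = l >] then f (sh (deg l) x) else 0).
Proof.
apply/asboolP => c f g; apply/funext => x; rewrite !fctE.
by case: ifP => // _; rewrite scaler0 addr0.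
Qed.
Definition branch_S l : endo V := Endo (branch_S_subproof l).

Lemma branch_G_subproof l :
  linear_pred (fun (f : V) x => if `[< D x /\ src l = rg x >] then f (act l x) else 0).
Proof.
apply/asboolP => c f g; apply/funext => x; rewrite !fctE.
by case: ifP => // _; rewrite scaler0 addr0.
Qed.
Definition branch_G l : endo V := Endo (branch_G_subproof l).

(** The case analysis that hides [ini] and [sh] from computations with [branch_S]. *)
Variant branch_spec l (f : V) x : R -> Prop :=
| BranchAct y of D y & src l = rg y & x = act l y : branch_spec l f x (f y)
| BranchOut of (forall y, D y -> src l = rg y -> x <> act l y) : branch_spec l f x 0.

Lemma branch_SP l f x : branch_spec l f x (branch_S l f x).
Proof.
rewrite /=; case: asboolP => [[Dx lx]|nx].
  have [Dy _ ly yx] := iniP (deg l) Dx; rewrite lx in ly yx.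
  exact: BranchAct.
constructor=> y Dy ly xy; apply: nx; rewrite xy.
by have [? _ -> _] := actP Dy ly.
Qed.

Lemma branch_S_act l f y : D y -> src l = rg y -> branch_S l f (act l y) = f y.
Proof.
move=> Dy ly; have [Dx _ lx yx] := actP Dy ly.
by rewrite /= yx lx asboolT.
Qed.

Lemma branch_G_in l f y : D y -> src l = rg y -> branch_G l f y = f (act l y).
Proof. by move=> Dy ly; rewrite /= asboolT. Qed.

Lemma branch_G_out l f y : ~ (D y /\ src l = rg y) -> branch_G l f y = 0.
Proof. by move=> ly; rewrite /= asboolF. Qed.

Lemma branch_G_vid v f x :
  branch_G (vid v) f x = if `[< D x /\ v = rg x >] then f x else 0.
Proof.
rewrite /= src_vid; case: asboolP => // -[Dx ->].
by rewrite act_vid.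
Qed.

Lemma branch_GS_vid v : branch_G (vid v) = branch_S (vid v).
Proof.
apply: endo_eq => f; apply/funext => x; rewrite branch_G_vid.
case: branch_SP => [y Dy|]; rewrite ?src_vid.
  by move=> -> ->; rewrite act_vid // asboolT.
move=> nx; rewrite asboolF // => -[Dx vx].
by apply: (nx x) => //; rewrite vx act_vid.
Qed.

Lemma branch_family : row_finite L -> path_family branch_S branch_G.
Proof.
move=> rf; split.
- exact: branch_GS_vid.
- move=> v w vw; apply: endo_eq => f; apply/funext => x.
  rewrite endoME -!branch_GS_vid !branch_G_vid.
  case: asboolP => // -[Dx vx]; rewrite asboolF // => -[_ wx].
  by rewrite vx wx eqxx in vw.
- move=> l m lm; split; apply: endo_eq => f; apply/funext => x; rewrite endoME.
    have src_lm : src (kcomp l m) = src m by apply: src_comp.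
    case: (branch_SP l) => [y Dy ly ->|nx].
      case: branch_SP => [z Dz mz ->|ny].
        by rewrite -act_comp // branch_S_act ?src_lm.
      (* Removing l from l y = l (m z) gives y = m z, contrary to [ny]. *)
      case: branch_SP => // z Dz; rewrite src_lm => mz; rewrite act_comp // => lyz.
      case: (ny z) => //; have [Dmz rmz _ _] := actP Dz mz.
      have [_ _ _ <-] := actP Dy ly; rewrite lyz.
      by have [|_ _ _ ->] := actP Dmz (l := l); rewrite ?rmz.
    case: branch_SP => // z Dz; rewrite src_lm => mz; rewrite act_comp // => xz.
    have [Dmz rmz _ _] := actP Dz mz.
    by case: (nx (act m z)); rewrite ?rmz.
  have src_lm : src (kcomp l m) = src m by apply: src_comp.
  have [[Dx mx]|nx] := EM (D x /\ src m = rg x); last by rewrite !branch_G_out ?src_lm.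
  have [Dmx rmx _ _] := actP Dx mx.
  by rewrite !branch_G_in ?rmx ?src_lm // act_comp.
- move=> l m dlm; apply: endo_eq => f; apply/funext => x; rewrite endoME.
  have -> : (if l == m then branch_S (vid (src l)) else 0) f x =
            if l == m then branch_S (vid (src l)) f x else 0 by case: eqP.
  rewrite -branch_GS_vid branch_G_vid; case: asboolP => [[Dx lx]|nx]; last first.
    by rewrite branch_G_out // if_same.
  rewrite branch_G_in //; case: eqVneq => [<-|lm]; first by rewrite branch_S_act.
  (* If l x = m y, both l and m are the initial path of this point in their common degree, so they
     agree. *)
  case: branch_SP => // y Dy my lxy; case/eqP: lm.
  have [_ _ <- _] := actP Dx lx; have [_ _ <- _] := actP Dy my.
  by rewrite lxy dlm.
- move=> v n; apply: endo_eq => f; apply/funext => x.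
  rewrite endo_fsbigE ?rf // -branch_GS_vid branch_G_vid.
  rewrite fsbig_finite ?rf // fct_sumE -(@fsbig_finite _ _ _ _ (paths_to v n)) ?rf //.
  (* In (KP4) only the initial path of degree n of x can contribute to the value at x. *)
  have term0 l : paths_to v n l -> ~ (D x /\ ini n x = l) -> (branch_S l ** branch_G l) f x = 0.
    move=> [_ dl] nx; rewrite endoME; case: branch_SP => // y Dy ly xy.
    by case: nx; rewrite xy -dl; have [? _ -> _] := actP Dy ly.
  case: asboolP => [[Dx vx]|nx]; last first.
    rewrite fsbig1 // => l vl; apply: (term0) => // -[Dx lx]; apply: nx; split=> //.
    have [Dy _ ly xy] := iniP n Dx; rewrite lx in ly xy.
    by have [_ + _ _] := actP Dy ly; rewrite xy; case: vl => -> _.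
  have [Dy dl ly xy] := iniP n Dx.
  have rl : rng (ini n x) = v by rewrite vx; have [_ <- _ _] := actP Dy ly; rewrite xy.
  rewrite (fsbigE [:: ini n x]) //; first last.
  + by move=> l vl; rewrite inE => /eqP nl; apply: term0 => // -[_ /esym].
  + by move=> l /=; rewrite inE => /eqP ->.
  rewrite big_cons big_nil ifT; last exact/mem_set.
  rewrite Monoid.mulm1 endoME -[X in branch_S _ _ X]xy.
  rewrite branch_S_act //.
  by rewrite branch_G_in // xy.
Qed.

End Branching.

(** * Infinite paths *)

Section Prefix.
Variables (k : nat) (L : kgraph k).
Implicit Types (l m b c z w : L) (n : 'rV[nat]_k).

(** Cancellation in N^k makes the degrees of [c] and [c'] agree too, and the factorization is
    unique. *)
Lemma comp_inj b c b' c' : src b = rng c -> src b' = rng c' -> deg b = deg b' ->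
  kcomp b c = kcomp b' c' -> b = b' /\ c = c'.
Proof.
move=> bc bc' db e; have de := congr1 deg e; rewrite !deg_comp // db in de.
have dc : deg c = deg c'.
  by apply/rowP => i; move/rowP: de => /(_ i); rewrite !mxE => /addnI.
have [mn [_ uniq_mn]] := factorization (deg_comp bc).
have e1 : mn = (b, c) by apply: uniq_mn.
have e2 : mn = (b', c') by apply: uniq_mn; split; rewrite ?e.
by move: e2; rewrite e1 => -[].
Qed.

Definition prefix b z : Prop := exists2 c, src b = rng c & z = kcomp b c.

Lemma prefix_refl b : prefix b b.
Proof. by exists (vid (src b)); rewrite ?rng_vid ?comp_vidr. Qed.

Lemma prefix_trans b w z : prefix b w -> prefix w z -> prefix b z.
Proof.
move=> [c bc ->] [d]; rewrite src_comp // => cd ->.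
by exists (kcomp c d); rewrite ?rng_comp // comp_assoc.
Qed.

Lemma prefix_rng b z : prefix b z -> rng z = rng b.
Proof. by move=> [c bc ->]; rewrite rng_comp. Qed.

Lemma prefix_comp l b z : src l = rng b -> prefix b z ->
  prefix (kcomp l b) (kcomp l z).
Proof. by move=> lb [c bc ->]; exists c; rewrite ?src_comp // comp_assoc. Qed.

Lemma prefix_ex l n n' : deg l = n + n' -> exists b, deg b = n /\ prefix b l.
Proof. by case/factorization => -[b c] [[/= db _ bc ->] _]; exists b; split=> //; exists c. Qed.

Lemma prefix_uniq b b' z : prefix b z -> prefix b' z -> deg b = deg b' -> b = b'.
Proof. by move=> [c bc ->] [c' bc' e] db; have [] := comp_inj bc bc' db e. Qed.

(** The initial segment of [w] of degree [deg b] is also one of [z], hence equals [b]. *)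
Lemma prefix_chain b w z n : prefix b z -> prefix w z -> deg w = deg b + n ->
  prefix b w.
Proof.
move=> bz wz /prefix_ex [b' [db b'w]].
by rewrite -(prefix_uniq (prefix_trans b'w wz) bz db).
Qed.

Lemma src_prefix_out (H : set (vertex L)) b z : hereditary H -> prefix b z ->
  ~ H (src z) -> ~ H (src b).
Proof.
by move=> hH [c bc ->]; rewrite src_comp // => nc; rewrite bc => /hH.
Qed.

End Prefix.

Section InfinitePaths.
Variables (k : nat) (L : kgraph k) (H : set (vertex L)).
Hypothesis hH : hereditary H.
Implicit Types (x y : 'rV[nat]_k -> L) (n : 'rV[nat]_k).

(* An infinite path is given by its initial segments x n of all degrees n. *)
Definition infinite_path x : Prop :=
  [/\ forall n, deg (x n) = n, forall m n, prefix (x m) (x (m + n)) &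
      forall n, ~ H (src (x n))].

Lemma infinite_path_rng y n : infinite_path y -> rng (y n) = rng (y 0).
Proof. by move=> [_ py _]; apply: prefix_rng; rewrite -[n]add0r. Qed.

(** The segment of degree n of the infinite path l y is cut out of l (y n), whose degree d(l) + n is
    large enough. The suffix is likewise read off from x (n + m) by removing x n. The default values
    of [xget] are not reached for infinite paths, composable with l in the case of [concat]. *)
Definition concat_graph l y n b : Prop := deg b = n /\ prefix b (kcomp l (y n)).
Definition concat (l : L) y n : L := xget l (concat_graph l y n).
Definition suffix_graph n x m c : Prop := src (x n) = rng c /\ x (n + m) = kcomp (x n) c.
Definition suffix n x m : L := xget (x n) (suffix_graph n x m).

Lemma concatP l y n : infinite_path y -> src l = rng (y 0) ->
  concat_graph l y n (concat l y n).
Proof.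
move=> yI ly; have [dy _ _] := yI.
apply: xgetPex; apply: (@prefix_ex _ _ _ _ (deg l)).
by rewrite deg_comp ?dy ?infinite_path_rng // addrC.
Qed.

Lemma suffixP n x m : infinite_path x -> suffix_graph n x m (suffix n x m).
Proof.
by move=> [dx px _]; have [c xc e] := px n m; apply: xgetPex; exists c.
Qed.

Lemma concat_infinite l y : infinite_path y -> src l = rng (y 0) ->
  infinite_path (concat l y).
Proof.
move=> yI ly; have cP n := concatP n yI ly.
have lyn n : src l = rng (y n) by rewrite infinite_path_rng.
have [dy py ny] := yI.
split=> [n|m n|n]; first by have [] := cP n.
  have [dm pm] := cP m; have [dmn pmn] := cP (m + n).
  apply: (@prefix_chain _ _ _ _ _ n _ pmn); last by rewrite dm dmn.
  by apply: prefix_trans pm _; apply: prefix_comp.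
have [_ pn] := cP n; apply: (src_prefix_out hH pn).
by rewrite src_comp.
Qed.

Lemma concat_tail l y n : infinite_path y -> src l = rng (y 0) ->
  concat l y (deg l + n) = kcomp l (y n).
Proof.
move=> yI ly; have [dy py _] := yI.
have lyn m : src l = rng (y m) by rewrite infinite_path_rng.
have [d p] := concatP (deg l + n) yI ly.
apply: (prefix_uniq p); last by rewrite d deg_comp // dy.
by apply: prefix_comp => //; rewrite addrC.
Qed.

(** The degrees d(l) + n are cofinal: x n is the initial segment of degree n of x (d(l) + n). *)
Lemma concat_uniq l x y : infinite_path x -> infinite_path y -> src l = rng (y 0) ->
  (forall n, x (deg l + n) = kcomp l (y n)) -> concat l y = x.
Proof.
move=> xI yI ly xE; apply/funext => n; have [d p] := concatP n yI ly.
have [dx px _] := xI.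
by apply: (prefix_uniq p); rewrite ?d ?dx // -xE addrC.
Qed.

Lemma suffix_uniq n x y : infinite_path x ->
  (forall m, src (x n) = rng (y m) /\ x (n + m) = kcomp (x n) (y m)) -> suffix n x = y.
Proof.
move=> xI yE; apply/funext => m; have [xs e] := suffixP n m xI; have [xy e'] := yE m.
have ee : kcomp (x n) (suffix n x m) = kcomp (x n) (y m) by rewrite -e -e'.
by have [] := comp_inj xs xy erefl ee.
Qed.

Lemma suffix_infinite n x : infinite_path x -> infinite_path (suffix n x).
Proof.
move=> xI; have [dx px nx] := xI; have sP m := suffixP n m xI.
split=> [m|m m'|m].
- have [xs e] := sP m; have := dx (n + m); rewrite e deg_comp // dx.
  by move=> /rowP de; apply/rowP => i; have := de i; rewrite !mxE => /addnI.
- have [xs e] := sP m; have [xs' e'] := sP (m + m').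
  have [c] := px (n + m) m'; rewrite -addrA e e' src_comp // => sc.
  rewrite -comp_assoc // => /comp_inj [] //; first by rewrite rng_comp.
  by move=> _ ->; exists c.
- by have [xs e] := sP m; have := nx (n + m); rewrite e src_comp.
Qed.

Lemma concat_suffix n x : infinite_path x -> concat (x n) (suffix n x) = x.
Proof.
move=> xI; have [dx _ _] := xI; apply: concat_uniq => //.
- exact: suffix_infinite.
- by have [] := suffixP n 0 xI.
- by move=> m; rewrite dx; have [] := suffixP n m xI.
Qed.

Lemma concat_init l y : infinite_path y -> src l = rng (y 0) ->
  concat l y (deg l) = l.
Proof.
move=> yI ly; have [dy _ _] := yI.
by rewrite -[deg l]addr0 concat_tail // (deg0_vid (dy 0)) -ly comp_vidr.
Qed.

Lemma suffix_concat l y : infinite_path y -> src l = rng (y 0) ->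
  suffix (deg l) (concat l y) = y.
Proof.
move=> yI ly; apply: suffix_uniq; first exact: concat_infinite.
by move=> m; rewrite concat_tail // concat_init // infinite_path_rng.
Qed.

Lemma concat_vid y : infinite_path y -> concat (vid (rng (y 0))) y = y.
Proof.
move=> yI; apply: concat_uniq => //; first by rewrite src_vid.
by move=> n; rewrite deg_vid add0r -(infinite_path_rng n yI) comp_vidl.
Qed.

Lemma concat_rng l y : infinite_path y -> src l = rng (y 0) ->
  rng (concat l y 0) = rng l.
Proof.
move=> yI ly; rewrite -(infinite_path_rng (deg l)) ?concat_init //.
exact: concat_infinite.
Qed.

Lemma concat_comp l m y : infinite_path y -> src l = rng m -> src m = rng (y 0) ->
  concat (kcomp l m) y = concat l (concat m y).
Proof.
move=> yI lm my; have myI := concat_infinite yI my.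
have lmy : src l = rng (concat m y 0) by rewrite concat_rng.
apply: concat_uniq => //; rewrite ?src_comp //.
  exact: concat_infinite.
move=> n; rewrite deg_comp // -addrA concat_tail // concat_tail // comp_assoc //.
by rewrite infinite_path_rng.
Qed.

(** By saturation, a vertex outside [H] is the range of a path of degree (1,...,1) with source
    outside [H]. Iteration gives paths [z i] of degree (i,...,i), each extending the previous one,
    and every [x n] is cut out of one of them. *)
Lemma infinite_path_through v : saturated H -> ~ H v ->
  exists2 x, infinite_path x & rng (x 0) = v.
Proof.
move=> sH nv; pose one : 'rV[nat]_k := const_mx 1%N.
have step w : exists l : L, ~ H w -> [/\ rng l = w, deg l = one & ~ H (src l)].
  apply: contrapT => nl; have nw : ~ H w by move=> Hw; apply: nl; exists (vid w).
  apply: nw; apply: (sH _ one) => _ [l [lw dl] <-].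
  by apply: contrapT => nHl; apply: nl; exists l.
have [f fP] := choice step.
pose z i := iter i (fun l => kcomp l (f (src l))) (vid v).
have zP i : deg (z i) = const_mx i /\ ~ H (src (z i)).
  elim: i => [|i [dz nz]] /=.
    by rewrite deg_vid src_vid; split=> //; apply/rowP => j; rewrite !mxE.
  have [rf df nf] := fP _ nz; rewrite deg_comp ?src_comp //; split=> //.
  by rewrite dz df; apply/rowP => j; rewrite !mxE; apply: addn1.
have zp i j : prefix (z i) (z (i + j)%N).
  elim: j => [|j IH]; first by rewrite addn0; apply: prefix_refl.
  rewrite addnS; apply: prefix_trans IH _.
  by exists (f (src (z (i + j)%N))) => //; have [] := fP _ (proj2 (zP (i + j)%N)).
(* The sum of the entries of n bounds each entry, so [z (N n)] has degree at least n. Additivity of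
   [N] puts the segments of degrees m and m + n inside a common [z i]. *)
pose N n := (\sum_j n ord0 j)%N.
have init n : exists b : L, deg b = n /\ prefix b (z (N n)).
  apply: (@prefix_ex _ _ _ _ (\row_j (N n - n ord0 j)%N)).
  rewrite (proj1 (zP _)); apply/rowP => j; rewrite !mxE; apply/esym/subnKC.
  by rewrite /N (bigD1 j) //= leq_addr.
have [x xP] := choice init; exists x; last first.
  have [_ /prefix_rng <-] := xP 0.
  by have := zp 0%N (N 0); rewrite add0n => /prefix_rng ->; rewrite rng_vid.
split=> [n|m n|n]; first by have [] := xP n.
  have [dm pm] := xP m; have [dmn pmn] := xP (m + n).
  apply: (@prefix_chain _ _ _ _ _ n _ pmn); last by rewrite dm dmn.
  apply: prefix_trans pm _; rewrite (_ : N (m + n) = (N m + N n)%N) //.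
  by rewrite /N -big_split /=; apply: eq_bigr => j _; rewrite mxE.
have [_ pn] := xP n; apply: (src_prefix_out hH pn).
by have [] := zP (N n).
Qed.

End InfinitePaths.

Lemma kp_ideal_of_vertex (k : nat) (R : comNzRingType) (L : kgraph k)
    (H : set (vertex L)) (v : vertex L) (c : R) :
  row_finite L -> hereditary H -> saturated H -> c != 0 ->
  kp_ideal_of H (c *: kp_p R v) -> H v.
Proof.
move=> rf hH sH c0 Iv; apply: contrapT => nv.
have [x xI xv] := infinite_path_through hH sH nv.
pose rg (y : 'rV[nat]_k -> L) := rng (y 0).
have iniP n y : infinite_path H y ->
    [/\ infinite_path H (suffix n y), deg (y n) = n, src (y n) = rg (suffix n y) &
        concat (y n) (suffix n y) = y].
  move=> yI; have [dy _ _] := yI; split=> //.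
  - exact: suffix_infinite.
  - by have [] := suffixP n 0 yI.
  - exact: concat_suffix yI.
have actP l y : infinite_path H y -> src l = rg y ->
    [/\ infinite_path H (concat l y), rg (concat l y) = rng l,
        concat l y (deg l) = l & suffix (deg l) (concat l y) = y].
  move=> yI ly; split; [exact: concat_infinite|exact: (concat_rng hH)|..].
    exact: (concat_init yI).
  exact: (suffix_concat hH).
have SG := branch_family R (ini := fun n y => y n) iniP actP
  (@concat_vid _ _ _) (@concat_comp _ _ _ hH) rf.
have [phi [phiD phiZ phiM phiS _]] := kp_representation SG.
have phi_p w (f : ('rV[nat]_k -> L) -> R^o) y : phi (kp_p R w) f y =
    if `[< infinite_path H y /\ w = rg y >] then f y else 0.
  rewrite -kp_s_vid phiS -(branch_GS_vid R iniP actP (@concat_vid _ _ _)).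
  by rewrite branch_G_vid //; apply: concat_vid.
have phi0 : phi 0 = 0 by rewrite -(scale0r 0) phiZ scale0r.
have : phi (c *: kp_p R v) = 0.
  (* The kernel of [phi] is an ideal, and it contains p_w for w in [H], since the range of an
     infinite path y is the source of [y 0] and thus not in [H]. *)
  apply: (Iv [set a | phi a = 0]); split=> [|_ [w Hw <-]] /=.
    split=> //= a b.
    - by rewrite phiD -scaleN1r phiZ => -> ->; rewrite scaler0 addr0.
    - by rewrite phiM => ->; rewrite numul0.
    - by rewrite phiM => ->; rewrite nu0mul.
  apply: endo_eq => f; apply/funext => y; rewrite phi_p; case: asboolP => // -[yI wy].
  case: yI => dy _ /(_ 0); rewrite (deg0_vid (dy 0)) src_vid => nw.
  by case: nw; rewrite -/(rg y) -wy.
(* Evaluation on the constant function 1 at the path x through v yields c = 0. *)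
rewrite phiZ => /(congr1 (fun e : endo _ => e (fun=> 1) x)).
rewrite endoZE fctE phi_p asboolT // => /eqP.
by rewrite /GRing.scale /= mulr1 (negPf c0).
Qed.

(** * The correspondence *)

Section Correspondence.
Variables (k : nat) (R : comNzRingType) (L : kgraph k).
Hypothesis L_rf : row_finite L.
Local Notation S := (@kp_s k R L).
Local Notation G := (@kp_g k R L).
Local Notation p := (@kp_p k R L).
Local Notation kpdeg := (@kp_degree k R L).
Local Notation fam := (kp_path_family R L_rf).

Let SGpair (q : L * L) : KP R L := S q.1 ** G q.2.

(** Fixing the degree of the second path fixes that of the first, so (KP3) applies between the
    corresponding paths of any two such pairs. *)
Definition normal_pair (n : 'rV[int]_k) (N : 'rV[nat]_k) (q : L * L) : Prop :=
  [/\ deg q.2 = N, src q.1 = src q.2 & degz q.1 = n + degz q.2].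

Lemma normal_pair_expand n N M q : normal_pair n N q ->
  lspan (SGpair @` normal_pair n (N + M)) (SGpair q).
Proof.
case: q => l m [/= dm lm dlm]; rewrite /SGpair /= (family_expand L_rf fam M) //.
apply: lspan_fsbig => [|u [ul du]]; first exact: L_rf.
apply: lspan_mem; exists (kcomp l u, kcomp m u) => //.
have um : src m = rng u by rewrite ul.
split; rewrite /= ?deg_comp ?src_comp ?dm ?du //.
by rewrite !degz_comp // dlm addrA.
Qed.

(** Terms whose paths have different sources vanish. The others are lengthened by
    [normal_pair_expand], the new term by N and the previous ones by d(m), to the common degree d(m)
    + N. *)
Lemma kp_normal_form n a : kpdeg n a ->
  exists N, lspan (SGpair @` normal_pair n N) a.
Proof.
elim/lspan_ind => [|c _ v [l [m [<- ->]]] [N vN]].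
  by exists 0; apply: lspan0.
have [lm|lm] := eqVneq (src l) (src m); last first.
  by exists N; rewrite (family_SG_neq fam) // scaler0 add0r.
exists (deg m + N); apply: lspanD.
  apply/lspanZ/(@normal_pair_expand _ _ _ (l, m)).
  by split; rewrite //= subrK.
elim/lspan_ind: vN => [|e _ w [q Nq <-] IH]; first exact: lspan0.
by apply: lspanD IH; apply: lspanZ; rewrite (addrC (deg m)); apply: normal_pair_expand.
Qed.

(** p_(s(l)) = s_l^* p_(r(l)) s_l. *)
Lemma ideal_vertices_hereditary (I : set (KP R L)) : is_ideal I ->
  hereditary [set v | I (p v)].
Proof.
move=> [_ _ IM MI] l /= Il.
have := family_GS fam (erefl (deg l)); rewrite eqxx kp_s_vid => <-.
by rewrite -(family_rngS fam) kp_s_vid; apply/IM/MI.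
Qed.

Lemma ideal_SG (I : set (KP R L)) l m : is_ideal I -> I (p (src l)) -> I (S l ** G m).
Proof.
move=> [_ _ IM MI] Il; rewrite -(family_Ssrc fam l) kp_s_vid.
exact: (MI _ _ (IM _ _ Il)).
Qed.

(** (KP4) writes p_v as a sum of terms s_l p_(s(l)) s_l^*. *)
Lemma ideal_vertices_saturated (I : set (KP R L)) : is_ideal I ->
  saturated [set v | I (p v)].
Proof.
move=> idI v n sH /=; have [_ _ _ _ /(_ v n)] := fam.
rewrite kp_s_vid => ->; rewrite fsbig_finite; last exact: L_rf.
apply: ideal_sum => // l; rewrite in_fset_set; last exact: L_rf.
by rewrite inE => vl; apply: ideal_SG => //; apply: sH; exists l.
Qed.

(* Multiplying by G l on the left and by S m on the right isolates the
   coefficient of (l, m) in the normal form. *)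
Lemma basic_ideal_homogeneous (I : set (KP R L)) n a : basic_ideal I ->
  I a -> kpdeg n a -> kp_ideal_of [set v | I (p v)] a.
Proof.
move=> [idI basI] Ia /kp_normal_form [N /lspan_image [e [c [ue eN aE]]]].
have [_ _ IM MI] := idI; have idH := ideal_gen_is_ideal (p @` [set v | I (p v)]).
rewrite aE; apply: ideal_sum => // -[l m] lm_e.
have [->|c0] := eqVneq (c (l, m)) 0; first by rewrite scale0r; case: idH.
apply: (kp_ideal_scale _ idH); apply: (@ideal_SG _ l m idH).
apply: sub_gen_smallest; exists (src l) => //=; apply: (basI _ _ c0).
have [/= dm lm dlm] := eN _ lm_e.
have <- : G l ** a ** S m = c (l, m) *: p (src l); last exact: (MI _ _ (IM _ _ Ia)).
rewrite aE (big_morph _ (numulDr (G l)) (numul0 _)) nusuml (bigD1_seq (l, m)) //=.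
have GSGS l' m' : (l', m') \in e -> G l ** (S l' ** G m') ** S m =
    if (l == l') && (m' == m) then p (src l) else 0.
  move=> /eN [/= dm' lm' dlm'].
  have dmm' : deg m' = deg m by rewrite dm'.
  (* Both l and l' have degree n + N, as (KP3) requires. *)
  rewrite !numulA (family_GS fam); last first.
    by apply: degz_inj; rewrite dlm dlm' /degz dmm'.
  rewrite -numulA (family_GS fam) //.
  case: (l =P l') => [ll|_] /=; last by rewrite nu0mul.
  case: eqP => _; last by rewrite numul0.
  by rewrite -lm' -ll (family_vv fam) eqxx kp_s_vid.
rewrite -nuscaleAr -nuscaleAl GSGS // !eqxx /= big1_seq ?addr0 //.
move=> [l' m'] /andP [neq e']; rewrite -nuscaleAr -nuscaleAl GSGS //.
rewrite ifF ?scaler0 //; apply: contraNF neq => /= /andP [/eqP -> /eqP ->].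
exact: eqxx.
Qed.

Lemma kp_ideal_of_graded H : graded_ideal (@kp_ideal_of k R L H).
Proof.
split; first exact: ideal_gen_is_ideal.
apply: kp_generated_graded => // _ [v _ <-]; exact: kp_degree_gen.
Qed.

(** The grading puts each component of an element of [I] into [I], where [basic_ideal_homogeneous]
    applies. *)
Lemma kp_ideal_ofE (I : set (KP R L)) : basic_ideal I -> graded_ideal I ->
  kp_ideal_of [set v | I (p v)] = I.
Proof.
move=> basI [idI [_ decI]]; apply/seteqP; split=> [|a Ia].
  by apply: smallest_sub => // _ [v Iv <-].
have [f [[[fin Nf] ->] _]] := decI a Ia.
have [s f0] := finite_support_seq fin.
rewrite (@fsbigT_seq _ _ _ (undup s)) ?undup_uniq // => [|j]; last first.
  by rewrite mem_undup; apply: f0.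
apply: ideal_sum => [|j _]; first exact: ideal_gen_is_ideal.
by have [Ifj dj] := Nf j; apply: basic_ideal_homogeneous dj.
Qed.

End Correspondence.

Lemma hereditary_saturated_lattice (k : nat) (L : kgraph k) :
  is_set_lattice [set H : set (vertex L) | hereditary H /\ saturated H].
Proof.
apply: closure_set_lattice => F FP; split.
  by move=> l Hl H FH; have [hH _] := FP H FH; exact: (hH _ (Hl _ FH)).
move=> v n sH H FH; have [_ satH] := FP H FH; by apply: (satH v n) => w /sH /(_ _ FH).
Qed.

Theorem theorem5p1 (k : nat) (k_gt0 : (0 < k)%N) (L : kgraph k)
    (R : comNzRingType) (L_row_finite : row_finite L)
    (L_no_sources : no_sources L) :
  set_lattice_iso
    [set H : set (vertex L) | hereditary H /\ saturated H]
    [set I : set (KP R L) | basic_ideal I /\ graded_ideal I]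
    (@kp_ideal_of k R L).
Proof.
(* The case r = 1: [H] is recovered from its ideal as the set of v with p_v in it, so inclusions of
   ideals give inclusions of vertex sets. *)
have memP (H : set (vertex L)) v : hereditary H -> saturated H ->
    @kp_ideal_of k R L H (kp_p R v) -> H v.
  move=> hH sH; rewrite -[kp_p R v]scale1r.
  by apply: kp_ideal_of_vertex => //; apply: oner_neq0.
have memI (H : set (vertex L)) v : H v -> @kp_ideal_of k R L H (kp_p R v).
  by move=> Hv; apply: sub_gen_smallest; exists v.
have le_iff (A B : set (vertex L)) : hereditary B /\ saturated B ->
    (A `<=` B <-> @kp_ideal_of k R L A `<=` @kp_ideal_of k R L B).
  move=> [hB sB]; split=> [AB|AB v Av]; last exact: (memP _ _ hB sB (AB _ (memI _ _ Av))).
  apply: smallest_sub => [|_ [v Av <-]]; first exact: ideal_gen_is_ideal.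
  exact: (memI _ _ (AB _ Av)).
apply: set_lattice_iso_of_bij; first exact: hereditary_saturated_lattice.
  split.
  - move=> H [hH sH]; split; last exact: kp_ideal_of_graded.
    split=> [|v c c0 Iv]; first exact: ideal_gen_is_ideal.
    exact: (memI _ _ (kp_ideal_of_vertex L_row_finite hH sH c0 Iv)).
  - move=> A B; rewrite !inE => PA PB AB.
    by apply/seteqP; split; apply/le_iff => //; rewrite AB.
  - move=> I [basI grI]; exists [set v | I (kp_p R v)]; last exact: kp_ideal_ofE.
    have [idI _] := grI.
    by split; [apply: ideal_vertices_hereditary|apply: ideal_vertices_saturated].
by move=> A B _ PB; apply: le_iff.
Qed.
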